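(* Consider the supercritical branching random walk $\overline{X}$ described in the context, with offspring distribution $(\overline{p}_k)_{k\ge0}$ having mean strictly greater than $1$, $\overline{p}_0>0$ and a finite third moment, and jump distribution $(a_y)_{y\in\mathbb{Z}}$ with mean zero, finite variance, $a_0<1$, and $K(\theta)<\infty$ for all $\theta\ge1$. Let $\bar f(\theta)=\sum_k\overline{p}_k\theta^k$, let $q\in(0,1)$ be the extinction probability, let $\overline{\rho}=\rho\big((\bar f'(q))^{-1}\big)$, let $\bar u(n)=P(\overline{M}\ge n)$, and let $\overline{\ell}(n):=\overline{\rho}^{\,n}\big(\bar u(n)-(1-q)\big)$. Then: (a) $0<\liminf_{n\to\infty}\overline{\ell}(n)\le\limsup_{n\to\infty}\overline{\ell}(n)\le q$. (b) Moreover, if $W$ has a finite right range $R$ and is nearly right-continuous, then there exists $\kappa'\in(0,q]$ such that $\lim_{n\to\infty}\overline{\ell}(n)=\kappa'$.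
   Context: Branching random walk: $(a_y)_{y\in\mathbb{Z}}$ is the jump distribution and $(\overline{p}_k)_{k\ge0}$ the offspring distribution. The process starts from a single particle (the root) at position $0$. In each generation particles first jump and then reproduce: each particle $v$ at position $\overline{X}(v)$, independently of all others, makes a jump $\xi_v$ with $P(\xi_v=y)=a_y$ and then produces $N_v$ children, where $P(N_v=k)=\overline{p}_k$ and $N_v$ is independent of $\xi_v$; all children of $v$ have position $\overline{X}(v)+\xi_v$ (if $N_v=0$, the jump leaves no trace). $\overline{M}$ is the supremum of the positions of all particles of all generations (including the root). The extinction probability is $q=P(\overline{Z}_n=0\text{ for some }n\ge1)$, where $\overline{Z}_n$ is the number of particles in generation $n$. Random walk: $W=(W_n)_{n\ge0}$ is the random walk on $\mathbb{Z}$ with $W_0=0$ and i.i.d. increments with law $(a_y)$. $K(\theta)=E(\theta^{W_1})$ for $\theta\ge1$; under the assumptions $K(1)=1$ and $K$ is strictly increasing to $\infty$ on $[1,\infty)$, and for $\gamma>1$, $\rho(\gamma)$ denotes the unique $s\in(1,\infty)$ with $K(s)=\gamma$. $W$ has a finite right range $R>0$ if $a_R>0$ and $a_k=0$ for all $k>R$; in that case $W$ is nearly right-continuous if $a_i>0$ for all $i=1,\dots,R$. *)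

(* Defs.v *)
From HB Require Import structures.
From mathcomp Require Import all_boot all_order all_algebra.
From mathcomp Require Import finmap.
From mathcomp Require Import all_classical all_reals all_analysis.

Set Implicit Arguments.
Unset Strict Implicit.
Unset Printing Implicit Defensive.

Import Order.TTheory GRing.Theory Num.Theory.
Import numFieldNormedType.Exports.

Local Open Scope classical_set_scope.
Local Open Scope ring_scope.

(* As for nat in the library: every set of integers is measurable. *)
HB.instance Definition _ := isPointed.Build int 0.
HB.instance Definition _ := @isMeasurable.Build default_measure_display
  int discrete_measurable discrete_measurable0
  discrete_measurableC discrete_measurableU.

Definition mass d (T : measurableType d) (R : realType)
  (mu : probability T R) (x : T) : R := fine (mu [set x]).

Section independence.
Context d d1 d2 (T : measurableType d) (T1 : measurableType d1)
  (T2 : measurableType d2) (R : realType) (P : probability T R).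

Definition independent_pair (X : T -> T1) (Y : T -> T2) : Prop :=
  forall (A : set T1) (B : set T2), measurable A -> measurable B ->
    P (X @^-1` A `&` Y @^-1` B) = (P (X @^-1` A) * P (Y @^-1` B))%E.

Definition mutually_independent (I : choiceType) (X : I -> T -> T1) : Prop :=
  forall (J : {fset I}) (A : I -> set T1),
    (forall i, measurable (A i)) ->
    P (\bigcap_(i in [set` J]) X i @^-1` A i) =
      (\prod_(i <- J) P (X i @^-1` A i))%E.

End independence.

(* Ulam-Harris labels, read from right to left: [::] is the root and i :: v is
   the i-th child of v, counted from 0. *)
Notation label := (seq nat).

(* For one realization, xi v is the jump of the particle v and N v the number
   of its children. The labels that do not belong to the family tree carry
   variables too, but these are not used. *)
Section tree.
Variables (xi : label -> int) (N : label -> nat).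

Fixpoint generation (n : nat) : seq label :=
  if n is m.+1
  then [seq i :: v | v <- generation m, i <- iota 0 (N v)]
  else [:: [::]].

Definition particle (v : label) : Prop := exists n, v \in generation n.

(* The position at birth, before the jump of the particle itself. *)
Fixpoint position (v : label) : int :=
  if v is _ :: u then position u + xi u else 0.

End tree.

Section branching_random_walk.
Context d (T : measurableType d) (R : realType) (P : probability T R).
Variables (a : probability int R) (p : probability nat R).
Variables (xi : label -> {RV P >-> int}) (N : label -> {RV P >-> nat}).

Record branching_random_walk : Prop := BranchingRandomWalk {
  jump_law : forall v y, P (xi v @^-1` [set y]) = a [set y];
  offspring_law : forall v k, P (N v @^-1` [set k]) = p [set k];
  jump_offspring_independent : forall v, independent_pair P (xi v) (N v);
  particles_independent :
    mutually_independent P (fun v t => (xi v t, N v t))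
}.

Definition generation_size (n : nat) (t : T) : nat :=
  size (generation (fun v => N v t) n).

Definition extinction_prob : R :=
  fine (P [set t | exists n, (1 <= n)%N /\ generation_size n t = 0%N]).

Definition maximal_position (t : T) : \bar R :=
  ereal_sup [set ((position (fun v => xi v t) v)%:~R)%:E
            | v in particle (fun v => N v t)].

Definition maximum_tail (n : nat) : R :=
  fine (P [set t | (n%:R%:E <= maximal_position t)%E]).

End branching_random_walk.

Section laws.
Context (R : realType).
Variables (a : probability int R) (p : probability nat R).

Definition offspring_gf (theta : R) : R := limn (pseries (mass p) theta).

(* K theta = E (theta ^ W_1), as W_1 has law a. *)
Definition step_gf (theta : R) : \bar R := 'E_a[fun y : int => theta ^ y].

Definition rho (gamma : R) : R :=
  xget 0 [set s | 1 < s /\ step_gf s = gamma%:E].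

Definition right_range (r : nat) : Prop :=
  [/\ (0 < r)%N, 0 < mass a r%:Z & forall y : int, r%:Z < y -> mass a y = 0].

Definition nearly_right_continuous (r : nat) : Prop :=
  right_range r /\ forall i : nat, (1 <= i <= r)%N -> 0 < mass a i%:Z.

End laws.

Definition rho_bar d (T : measurableType d) (R : realType)
    (P : probability T R) (a : probability int R) (p : probability nat R)
    (N : label -> {RV P >-> nat}) : R :=
  rho a (derive1 (offspring_gf p) (extinction_prob N))^-1.

Definition ell_bar d (T : measurableType d) (R : realType)
    (P : probability T R) (a : probability int R) (p : probability nat R)
    (xi : label -> {RV P >-> int}) (N : label -> {RV P >-> nat}) (n : nat) : R :=
  rho_bar a p N ^+ n * (maximum_tail xi N n - (1 - extinction_prob N)).

(* Main.v *)
(* Write w(n) for the probability that all particles stay below n, f for the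
   offspring generating function and h = q - w. Decomposing at the root gives
   w(n) = E f(w(n - xi)) for n > 0, hence h(n) = E phi(h(n - xi)) with
   phi(x) = f(q) - f(q - x), and m x - C x^2 <= phi(x) <= m x with m = f'(q).
   Since m K(rho) = 1 and m < 1, a maximum principle compares h with
   q rho^(-n) from above and with a perturbation of e rho^(-n) from below,
   which gives (a). For (b), the same principle shows that an upper bound for
   rho^n h(n) on a window as long as the right range persists to its right,
   and near right-continuity makes rho^n h(n) close to its lower limit on
   such windows.

   That w <= q, i.e. that surviving populations are unbounded above, follows
   from the same recursion and E xi = 0: otherwise w increases to 1, and
   1 - w would gain a factor > 1 when averaged over a jump. *)
Require Import Defs.
From HB Require Import structures.
From mathcomp Require Import all_boot all_order all_algebra.
From mathcomp Require Import finmap.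
From mathcomp Require Import all_classical all_reals all_analysis.
From mathcomp Require Import ring lra zify.

Set Implicit Arguments.
Unset Strict Implicit.
Unset Printing Implicit Defensive.

Import Order.TTheory GRing.Theory Num.Theory.
Import numFieldNormedType.Exports.

Local Open Scope classical_set_scope.
Local Open Scope ring_scope.

(** * Discrete probability spaces *)

(** Probability enters only through events of bounded depth: there independence gives an exact
    formula over finitely many labels, and continuity of the measure carries it to extinction and to
    the all-time maximum. The rest is analysis of functions on the integers. The maximum principle
    takes the place of stopping arguments for the walk: as [m < 1], a difference [D] that is bounded
    above and shrinks by the factor [m] at each use of the recursion cannot be positive, with no
    further condition at infinity. Because [phi x <= m * x], the pure exponential is only a
    supersolution, which is why the lower bound calls for a corrected comparison function. There the
    recursion is summed over a long window: zero mean cancels the linear boundary term at the near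
    end, and an exponential moment controls the far end. *)

Definition discrete d (S : measurableType d) : Prop :=
  (forall A : set S, measurable A) /\ countable [set: S].

Lemma discrete_nat : discrete nat.
Proof. by split=> //; exact: countableP. Qed.

Lemma discrete_int : discrete int.
Proof. by split=> //; exact: countableP. Qed.

Section discrete_integration.
Context d (S : measurableType d) (R : realType) (mu : probability S R).
Hypothesis discS : discrete S.

Lemma discrete_measurable_fun d' (S' : sigmaRingType d') (D : set S)
    (f : S -> S') : measurable_fun D f.
Proof. by move=> _ B _; exact: discS.1. Qed.

Lemma integral_atom (z : S) (g : S -> \bar R) :
  (\int[mu]_(x in [set z]) g x = g z * mu [set z])%E.
Proof.
have mz : measurable [set z] by exact: discS.1.
rewrite (eq_integral (cst (g z))) ?integral_cst//.
by move=> x; rewrite inE => ->.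
Qed.

Lemma atom_le_integral (z : S) (g : S -> \bar R) :
  (forall x, (0 <= g x)%E) -> (g z * mu [set z] <= \int[mu]_x g x)%E.
Proof.
move=> g0; rewrite -integral_atom ge0_subset_integral//.
- exact: discS.1.
- exact: discrete_measurable_fun.
Qed.

(** An injection of the value space into [nat] cuts both sides into series over the same fibres;
    each fibre is empty or a single point, where the terms agree by hypothesis. *)
Lemma total_probability d' (T : measurableType d') (P : probability T R)
    (Z : T -> S) (A : set T) (g : S -> \bar R) :
  (forall z, measurable (A `&` Z @^-1` [set z])) ->
  (forall z, (0 <= g z)%E) ->
  (forall z, P (A `&` Z @^-1` [set z]) = g z * mu [set z])%E ->
  P A = (\int[mu]_z g z)%E.
Proof.
move=> mA g0 gE; have /countable_injP[f f_inj] := discS.2.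
have f_inj' x y : f x = f y -> x = y by apply: f_inj; rewrite inE.
pose F k := f @^-1` [set k].
have FU : \bigcup_k F k = setT by apply/seteqP; split=> // x _; exists (f x).
have FE k : F k = set0 \/ exists z, F k = [set z].
  have [[z zk]|nz] := pselect (exists z, f z = k).
    right; exists z; apply/seteqP; split => x; rewrite /F/=; last by move=> ->.
    by move=> xk; apply: f_inj'; rewrite zk.
  by left; apply/seteqP; split => // x xk; apply: nz; exists x.
have AU : A = \bigcup_k (A `&` Z @^-1` F k).
  by rewrite -setI_bigcupr -preimage_bigcup FU preimage_setT setIT.
have mAF k : measurable (A `&` Z @^-1` F k).
  by case: (FE k) => [->|[z ->]]; rewrite ?preimage_set0 ?setI0.
rewrite {1}AU measure_bigcup//; last first.
  by apply/trivIsetP => i j _ _ ij; apply/seteqP; split => // t [[_ Fi] [_ Fj]];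
    move/eqP: ij; apply; exact: etrans (esym Fi) Fj.
rewrite -FU ge0_integral_bigcup//; last 3 first.
  by move=> k; exact: discS.1.
  exact: discrete_measurable_fun.
  by apply/trivIsetP => i j _ _ ij; apply/seteqP; split => // t [Fi Fj];
    move/eqP: ij; apply; exact: etrans (esym Fi) Fj.
rewrite eseries_mkcond; apply: eq_eseriesr => k _.
rewrite in_setT; case: (FE k) => [->|[z ->]].
  by rewrite preimage_set0 setI0 measure0 integral_set0.
by rewrite integral_atom; exact: gE.
Qed.

Lemma integral_gt0_atom (g : S -> \bar R) : (forall x, (0 <= g x)%E) ->
  (0 < \int[mu]_x g x)%E -> exists z, (0 < g z)%E /\ 0 < mass mu z.
Proof.
move=> g0 Ig; apply: contrapT => /forallNP H.
suff : (\int[mu]_x g x = 0)%E by move=> h; rewrite h ltxx in Ig.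
(* With [A = set0] and [Z = id], the integral becomes the probability of the empty event once every
   product [g z * mu [set z]] is shown to vanish. *)
rewrite -(@total_probability _ S mu id set0 g) ?measure0//.
  by move=> z; exact: discS.1.
move=> z; rewrite set0I measure0; have [->|gz] := eqVneq (g z) 0%E.
  by rewrite mul0e.
suff -> : mu [set z] = 0%E by rewrite mule0.
apply/eqP/negPn/negP => mz; apply: (H z); split; first by rewrite lt0e gz g0.
rewrite /mass fine_gt0// lt0e measure_ge0 mz/=.
by rewrite (le_lt_trans (probability_le1 mu (discS.1 _)))// ltry.
Qed.
End discrete_integration.

Section expectation.
Context d (S : measurableType d) (R : realType) (mu : probability S R).
Hypothesis discS : discrete S.

Definition summable (f : S -> R) : Prop := mu.-integrable setT (EFin \o f).

Definition mean (f : S -> R) : R := \int[mu]_x f x.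

Lemma summable_dom (f g : S -> R) : summable g ->
  (forall x, `|f x| <= g x) -> summable f.
Proof.
move=> ig fg; apply: le_integrable ig => //.
- exact: discrete_measurable_fun.
- move=> x _ /=; rewrite lee_fin.
  exact: le_trans (fg x) (ler_norm _).
Qed.

Lemma summable_cst (c : R) : summable (fun=> c).
Proof. exact: finite_measure_integrable_cst. Qed.

Lemma summable_bounded (f : S -> R) (c : R) :
  (forall x, `|f x| <= c) -> summable f.
Proof. exact/summable_dom/summable_cst. Qed.

Lemma summable_ge0 (f : S -> R) : (forall x, 0 <= f x) ->
  (\int[mu]_x (f x)%:E < +oo)%E -> summable f.
Proof.
move=> f0 fi; apply/integrableP; split; first exact: discrete_measurable_fun.
rewrite (eq_integral (EFin \o f)) // => x _ /=.
by rewrite ger0_norm.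
Qed.

Lemma summableD (f g : S -> R) : summable f -> summable g ->
  summable (fun x => f x + g x).
Proof. by move=> sf sg; exact: (integrableD measurableT sf sg). Qed.

Lemma summableZ (c : R) (f : S -> R) : summable f ->
  summable (fun x => c * f x).
Proof. by move=> sf; exact: (integrableZl measurableT c sf). Qed.

Lemma summableN (f : S -> R) : summable f -> summable (fun x => - f x).
Proof. by move=> sf; under eq_fun do rewrite -mulN1r; exact: summableZ. Qed.

Lemma summableB (f g : S -> R) : summable f -> summable g ->
  summable (fun x => f x - g x).
Proof. by move=> sf sg; apply: summableD => //; exact: summableN. Qed.

Lemma summable_sum (I : Type) (r : seq I) (F : I -> S -> R) :
  (forall i, summable (F i)) -> summable (fun x => \sum_(i <- r) F i x).
Proof.
move=> sF; elim: r => [|i r IH].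
  by under eq_fun do rewrite big_nil; exact: summable_cst.
by under eq_fun do rewrite big_cons; exact: summableD.
Qed.

Lemma mean_integral (f : S -> R) : summable f ->
  (\int[mu]_x (f x)%:E = (mean f)%:E)%E.
Proof. by move=> sf; rewrite /mean /Rintegral fineK// integrable_fin_num. Qed.

Lemma eq_mean (f g : S -> R) : f =1 g -> mean f = mean g.
Proof. by move=> /funext ->. Qed.

Lemma mean_cst (c : R) : mean (fun=> c) = c.
Proof.
rewrite /mean Rintegral_cst//.
by rewrite [X in fine X](@probability_setT _ _ _ mu) /= mulr1.
Qed.

Lemma meanD (f g : S -> R) : summable f -> summable g ->
  mean (fun x => f x + g x) = mean f + mean g.
Proof. by move=> sf sg; exact: RintegralD. Qed.

Lemma meanZ (c : R) (f : S -> R) : summable f ->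
  mean (fun x => c * f x) = c * mean f.
Proof. by move=> sf; exact: RintegralZl. Qed.

Lemma meanB (f g : S -> R) : summable f -> summable g ->
  mean (fun x => f x - g x) = mean f - mean g.
Proof. by move=> sf sg; exact: RintegralB. Qed.

Lemma mean_sum (I : Type) (r : seq I) (F : I -> S -> R) :
  (forall i, summable (F i)) ->
  mean (fun x => \sum_(i <- r) F i x) = \sum_(i <- r) mean (F i).
Proof.
move=> sF; elim: r => [|i r IH].
  by rewrite big_nil; under eq_mean do rewrite big_nil; rewrite mean_cst.
rewrite big_cons -IH; under eq_mean do rewrite big_cons.
by rewrite meanD//; exact: summable_sum.
Qed.

Lemma le_mean (f g : S -> R) : summable f -> summable g ->
  (forall x, f x <= g x) -> mean f <= mean g.
Proof. by move=> sf sg fg; apply: le_Rintegral. Qed.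

Lemma mean_ge0 (f : S -> R) : (forall x, 0 <= f x) -> 0 <= mean f.
Proof. by move=> f0; apply: Rintegral_ge0. Qed.

Lemma mass_ge0 (z : S) : 0 <= mass mu z.
Proof. exact: fine_ge0. Qed.

Lemma massE (z : S) : mu [set z] = (mass mu z)%:E.
Proof. by rewrite /mass fineK// fin_num_measure//; exact: discS.1. Qed.

Lemma mass_le_mean (f : S -> R) (z : S) : summable f ->
  (forall x, 0 <= f x) -> f z * mass mu z <= mean f.
Proof.
move=> sf f0; rewrite -lee_fin -mean_integral// EFinM -massE.
by apply: atom_le_integral => // x; rewrite lee_fin.
Qed.

Lemma mean_gt0_mass (f : S -> R) : summable f -> (forall x, 0 <= f x) ->
  0 < mean f -> exists z, 0 < f z /\ 0 < mass mu z.
Proof.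
move=> sf f0; rewrite -lte_fin -mean_integral// => h.
have f0' x : (0 <= (EFin \o f) x)%E by rewrite /= lee_fin.
have [z [fz mz]] := integral_gt0_atom discS f0' h.
by exists z; split; rewrite -?lte_fin.
Qed.

(** The excess [max 0 (f - g)] has mean zero, since a positive mean would give it a charged point.
    This is how a bounded right range enters: jumps of mass zero may be ignored. *)
Lemma le_mean_mass (f g : S -> R) : summable f -> summable g ->
  (forall x, 0 < mass mu x -> f x <= g x) -> mean f <= mean g.
Proof.
move=> sf sg fg; pose e x := Num.max 0 (f x - g x).
have e0 x : 0 <= e x by rewrite /e le_max lexx.
have se : summable e.
  apply: (@summable_dom _ (fun x => `|f x - g x|)).
    rewrite /summable; exact: (integrable_abse (summableB sf sg)).
  by move=> x; rewrite ger0_norm// /e ge_max normr_ge0 ler_norm.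
have me0 : mean e = 0.
  apply/eqP; rewrite eq_le mean_ge0// andbT leNgt; apply/negP.
  move=> /(mean_gt0_mass se e0)[z [ez mz]].
  by move: ez; rewrite /e lt_max ltxx/= subr_gt0 ltNge fg.
rewrite -[leRHS]addr0 -me0 -meanD//; apply: le_mean => //; first exact: summableD.
by move=> x; rewrite -lerBlDl /e le_max lexx orbT.
Qed.

Lemma mean_atom (i : S) : mean (fun k => (k == i)%:R) = mass mu i.
Proof.
rewrite /mean /Rintegral /mass; congr fine.
rewrite (eq_integral (fun k => (\1_[set i] k)%:E)).
  by rewrite integral_indic// ?setIT//; exact: discS.1.
by move=> k _; rewrite indicE in_set1.
Qed.

Lemma mean_cvg (F : nat -> S -> R) (f : S -> R) (c : R) :
  (forall n x, `|F n x| <= c) -> (forall x, F ^~ x @ \oo --> f x) ->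
  mean (F n) @[n --> \oo] --> mean f.
Proof.
move=> Fc Ff.
have fc x : `|f x| <= c.
  apply: (@closed_cvg _ _ \oo eventually_filter (fun n => `|F n x|) (fun y => y <= c)).
  - exact: closed_le.
  - by near=> n.
  - by apply: cvg_norm; exact: Ff.
have sF n : summable (F n) by exact: summable_bounded.
have sf : summable f by exact: summable_bounded.
have [_ _ H] : [/\ mu.-integrable setT (EFin \o f),
    (\int[mu]_x (`| (EFin \o F n) x - (EFin \o f) x |) @[n --> \oo] --> 0)%E &
    (\int[mu]_x ((EFin \o F n) x) @[n --> \oo] --> \int[mu]_x ((EFin \o f) x))%E].
  apply: (@dominated_convergence _ S R mu setT measurableT (fun n => EFin \o F n)
    (EFin \o f) (EFin \o cst c)).
  - by move=> n; exact: discrete_measurable_fun.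
  - exact: discrete_measurable_fun.
  - apply: aeW => x _ /=; apply/fine_cvgP; split; first by near=> n.
    exact: Ff.
  - exact: finite_measure_integrable_cst.
  - by apply: aeW => x n _ /=; rewrite lee_fin.
by move: H; rewrite (mean_integral sf) => /fine_cvgP[_].
Unshelve. all: by end_near.
Qed.

End expectation.

(** * The offspring generating function *)

(** Induction on [k]: the next remainder is [x * D + k%:R * t ^+ k.-1 * (x - t) ^+ 2]. The crude
    factor [k%:R ^+ 2] averages to the second moment of the offspring law. *)
Lemma expr_tangent (R : realFieldType) (k : nat) (t x : R) :
  0 <= t <= 1 -> 0 <= x <= 1 ->
  0 <= x ^+ k - t ^+ k - k%:R * t ^+ k.-1 * (x - t) <= k%:R ^+ 2 * (x - t) ^+ 2.
Proof.
move=> /andP[t0 t1] /andP[x0 x1].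
elim: k => [|k /andP[IH0 IH1]]; first by rewrite !expr0; apply/andP; split; lra.
set D := (X in 0 <= X) in IH0; set D' := (X in 0 <= X <= _).
have -> : D' = x * D + k%:R * t ^+ k.-1 * (x - t) ^+ 2.
  rewrite /D' /D /= -natr1; case: k {IH0 IH1 D D'} => [|k] /=; rewrite ?exprS; ring.
have k0 : (0 : R) <= k%:R by [].
have tk0 : 0 <= t ^+ k.-1 by exact: exprn_ge0.
have tk1 : t ^+ k.-1 <= 1 by exact: exprn_ile1.
have sq0 : 0 <= (x - t) ^+ 2 by exact: sqr_ge0.
have h1 : x * D <= k%:R ^+ 2 * (x - t) ^+ 2 by rewrite (le_trans _ IH1)// ler_piMl.
have h2 : k%:R * t ^+ k.-1 * (x - t) ^+ 2 <= k%:R * (x - t) ^+ 2.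
  by rewrite ler_wpM2r// ler_piMr.
apply/andP; split; first (apply: addr_ge0; [exact: mulr_ge0|by do 2![apply: mulr_ge0 => //]]).
rewrite -natr1; have -> : (k%:R + 1) ^+ 2 * (x - t) ^+ 2 =
  k%:R ^+ 2 * (x - t) ^+ 2 + k%:R * (x - t) ^+ 2 + (k%:R + 1) * (x - t) ^+ 2 by ring.
have : 0 <= (k%:R + 1) * (x - t) ^+ 2 by rewrite mulr_ge0// addr_ge0.
lra.
Qed.

Section offspring.
Context (R : realType) (p : probability nat R).

(** Expectation form of [offspring_gf], accessible to the integration lemmas; [offspring_gfE]
    identifies the two on the unit interval. *)
Definition gf (x : R) : R := mean p (fun k => x ^+ k).

Definition gf_slope (t : R) : R := mean p (fun k => k%:R * t ^+ k.-1).

Definition second_moment : R := mean p (fun k => k%:R ^+ 2).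

Hypothesis p2 : summable p (fun k => k%:R ^+ 2).
Let discN := discrete_nat.

Lemma summable_gf x : 0 <= x <= 1 -> summable p (fun k => x ^+ k).
Proof.
move=> /andP[x0 x1]; apply: (@summable_bounded _ _ _ p discN _ 1) => k.
by rewrite ger0_norm ?exprn_ge0// exprn_ile1.
Qed.

Lemma summable_gf_slope t : 0 <= t <= 1 ->
  summable p (fun k => k%:R * t ^+ k.-1).
Proof.
move=> /andP[t0 t1]; apply: (summable_dom discN p2) => k.
rewrite ger0_norm; last by apply: mulr_ge0 => //; exact: exprn_ge0.
case: k => [|k]; first by rewrite mul0r expr0n.
rewrite expr2 ler_wpM2l//=.
by rewrite (@le_trans _ _ 1) ?exprn_ile1// ler1n.
Qed.

Lemma second_moment_ge0 : 0 <= second_moment.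
Proof. by apply: mean_ge0 => k; exact: sqr_ge0. Qed.

(** The lower half is convexity, used to compare tangents with the diagonal; the upper half yields
    differentiability and, later, the quadratic error of [phi]. *)
Lemma gf_tangent t x : 0 <= t <= 1 -> 0 <= x <= 1 ->
  0 <= gf x - gf t - gf_slope t * (x - t) <= second_moment * (x - t) ^+ 2.
Proof.
move=> t01 x01.
have st := summable_gf t01; have sx := summable_gf x01.
have ss := summable_gf_slope t01.
have ss' := summableZ (x - t) ss.
have -> : gf x - gf t - gf_slope t * (x - t) =
    mean p (fun k => x ^+ k - t ^+ k - (x - t) * (k%:R * t ^+ k.-1)).
  rewrite meanB//; last by exact: (summableB sx st).
  by rewrite meanB// meanZ// [_ * (x - t)]mulrC.
apply/andP; split.
  apply: mean_ge0 => k.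
  by have /andP[+ _] := expr_tangent k t01 x01; rewrite [_ * (x - t)]mulrC.
rewrite /second_moment mulrC -meanZ//; apply: le_mean => //.
- by apply: summableB => //; exact: summableB.
- exact: summableZ.
move=> k; have /andP[_] := expr_tangent k t01 x01.
by rewrite [_ * (x - t)]mulrC [_ * _ ^+ 2]mulrC.
Qed.

Lemma gf1 : gf 1 = 1.
Proof. by rewrite /gf; under eq_mean do rewrite expr1n; exact: mean_cst. Qed.

Lemma gf_ge0 x : 0 <= x -> 0 <= gf x.
Proof. by move=> x0; apply: mean_ge0 => k; exact: exprn_ge0. Qed.

Lemma le_gf x y : 0 <= x -> x <= y -> y <= 1 -> gf x <= gf y.
Proof.
move=> x0 xy y1; apply: le_mean; try by apply: summable_gf; lra.
by move=> k; apply: lerXn2r => //; rewrite nnegrE (le_trans x0).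
Qed.

Lemma gf_le1 x : 0 <= x <= 1 -> gf x <= 1.
Proof. by move=> /andP[x0 x1]; rewrite -gf1 le_gf. Qed.

Lemma le_gf_slope x y : 0 <= x -> x <= y -> y <= 1 -> gf_slope x <= gf_slope y.
Proof.
move=> x0 xy y1; apply: le_mean; try by apply: summable_gf_slope; lra.
by move=> k; rewrite ler_wpM2l// lerXn2r// nnegrE (le_trans x0).
Qed.

Lemma gf_slope_ge0 t : 0 <= t -> 0 <= gf_slope t.
Proof. by move=> t0; apply: mean_ge0 => k; rewrite mulr_ge0 ?exprn_ge0. Qed.

Lemma gf_slope_gt0 t : 0 < mean p (fun k => k%:R) -> 0 < t <= 1 ->
  0 < gf_slope t.
Proof.
move=> p1 /andP[t0 t1].
have s1 : summable p (fun k => k%:R).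
  by have := summable_gf_slope (t := 1); under eq_fun do rewrite expr1n mulr1; apply; lra.
have [k [k0 pk]] := mean_gt0_mass discN s1 (fun k => ler0n R k) p1.
have /lt_le_trans := mulr_gt0 (mulr_gt0 k0 (exprn_gt0 k.-1 t0)) pk.
apply; apply: (@mass_le_mean _ _ _ p discN (fun k => k%:R * t ^+ k.-1)).
  by apply: summable_gf_slope; lra.
by move=> j; rewrite mulr_ge0// exprn_ge0// ltW.
Qed.

Lemma gf_slope1 : gf_slope 1 = mean p (fun k => k%:R).
Proof. by apply: eq_mean => k; rewrite expr1n mulr1. Qed.

Lemma gf_lipschitz x y : 0 <= x -> x <= y -> y <= 1 ->
  gf y - gf x <= gf_slope y * (y - x).
Proof.
move=> x0 xy y1.
have /andP[] := @gf_tangent y x ltac:(lra) ltac:(lra).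
lra.
Qed.

Lemma gf_cvg (s : nat -> R) (l : R) : (forall k, 0 <= s k <= 1) -> 0 <= l <= 1 ->
  s @ \oo --> l -> gf (s k) @[k --> \oo] --> gf l.
Proof.
move=> s01 l01 sl; have gf_dist x y : 0 <= x -> x <= y -> y <= 1 ->
    `|gf y - gf x| <= gf_slope 1 * (y - x).
  move=> x0 xy y1; rewrite ger0_norm ?subr_ge0 ?le_gf//.
  rewrite (le_trans (gf_lipschitz x0 xy y1))// ler_wpM2r ?subr_ge0// le_gf_slope//.
  exact: le_trans xy.
have m0 : 0 < gf_slope 1 + 1 by rewrite ltr_wpDl// gf_slope_ge0.
apply/cvgrPdist_le => e e0.
have /cvgrPdist_le/(_ _ (divr_gt0 e0 m0)) := sl; apply: filterS => k.
rewrite ler_pdivlMr// mulrDr mulr1 => H.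
have : gf_slope 1 * `|l - s k| <= e.
  by rewrite mulrC; apply: le_trans H; rewrite lerDl.
apply: le_trans; have /andP[s0 s1] := s01 k; have /andP[l0 l1] := l01.
have [ls|/ltW sl'] := leP l (s k).
  by rewrite distrC (distrC l) [X in _ * X]ger0_norm ?subr_ge0// gf_dist.
by rewrite [X in _ * X]ger0_norm ?subr_ge0// gf_dist.
Qed.

(** The partial sums of the series are the means of [x ^+ k] cut off at [k < n], so bounded
    convergence applies. *)
Lemma offspring_gfE x : 0 <= x <= 1 -> offspring_gf p x = gf x.
Proof.
move=> x01; apply/cvg_lim => //.
have H := @mean_cvg _ _ _ p discN
  (fun n k => \sum_(0 <= i < n) x ^+ i * (k == i)%:R) (fun k => x ^+ k) 1.
have E n k : \sum_(0 <= i < n) x ^+ i * (k == i)%:R = if (k < n)%N then x ^+ k else 0 :> R.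
  rewrite big_mkord; case: ifPn => kn.
    rewrite (bigD1 (Ordinal kn))//= eqxx mulr1 big1 ?addr0// => i.
    by rewrite -val_eqE/= eq_sym => /negbTE->; rewrite mulr0.
  rewrite big1// => i _; rewrite gtn_eqF ?mulr0//.
  by rewrite (leq_trans (ltn_ord i))// leqNgt.
have x0 : 0 <= x by lra.
apply: cvg_trans (H _ _).
- apply: near_eq_cvg; near=> n.
  rewrite /pseries /series /= mean_sum//; last first.
    move=> i; apply: summableZ => //; apply: (@summable_bounded _ _ _ p discN _ 1).
    by move=> k; case: eqP; rewrite ?normr0 ?normr1.
  apply: eq_bigr => i _; rewrite meanZ ?(mean_atom _ discN)//; first by rewrite mulrC.
  apply: (@summable_bounded _ _ _ p discN _ 1) => k.
  by case: eqP; rewrite ?normr0 ?normr1.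
- move=> n k; rewrite E; case: ifP => _; last by rewrite normr0.
  by rewrite ger0_norm ?exprn_ge0// exprn_ile1//; lra.
- move=> k; apply: cvg_near_cst; near=> n; rewrite E ifT//.
  by near: n; exact: nbhs_infty_gt.
Unshelve. all: by end_near.
Qed.

Lemma derive1_offspring_gf t : 0 < t < 1 ->
  derive1 (offspring_gf p) t = gf_slope t.
Proof.
move=> /andP[t0 t1]; rewrite /derive1; apply/cvg_lim => //.
apply/cvgrPdist_le => e e0; near=> h.
have hn0 : h != 0 by near: h; exact: nbhs_dnbhs_neq.
have hs : `|h| < Num.min t (1 - t).
  near: h; apply: dnbhs0_lt; rewrite lt_min t0/=; lra.
have hC : `|h| <= e / (second_moment + 1).
  by near: h; apply: dnbhs0_le; rewrite divr_gt0// ltr_wpDl// second_moment_ge0.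
have th : 0 <= h + t <= 1.
  by move: hs; rewrite lt_min !ltr_norml; lra.
rewrite !offspring_gfE//; last by lra.
have t01 : 0 <= t <= 1 by lra.
have := gf_tangent t01 th; rewrite addrK => /andP[D0 D1].
have -> : gf_slope t - h^-1 *: (gf (h + t) - gf t) =
    - (h^-1 * (gf (h + t) - gf t - gf_slope t * h)).
  by rewrite /GRing.scale/=; field.
rewrite normrN normrM normfV ler_pdivrMl ?normr_gt0// ger0_norm//.
rewrite (le_trans D1)// -real_normK ?num_real// expr2 mulrCA ler_wpM2l//.
have := second_moment_ge0; move: hC; rewrite ler_pdivlMr ?ltr_wpDl ?second_moment_ge0//.
have := normr_ge0 h; nra.
Unshelve. all: by end_near.
Qed.

End offspring.

(** * The extinction probability as the limit of the iterates of [gf p] from 0 *)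

Section fixpoint.
Context (R : realType) (p : probability nat R) (q : R).
Hypothesis p2 : summable p (fun k => k%:R ^+ 2).
Hypothesis p1 : 1 < mean p (fun k => k%:R).
Hypothesis p0 : 0 < mass p 0%N.
Hypothesis q_lim : iter k (gf p) 0 @[k --> \oo] --> q.

(** The slope at 1 is the mean [M > 1]. The choice of [e] keeps the quadratic error below half of
    the excess [M - 1], and the other half gives [c]. *)
Lemma gf_repulsive : exists2 e : R, 0 < e <= 1 & exists2 c : R, 1 < c &
  forall x, 0 <= x <= e -> c * x <= 1 - gf p (1 - x).
Proof.
have := p1; set M := mean p _ => M1; set C := second_moment p.
have C0 : 0 <= C by exact: second_moment_ge0.
have d0 : 0 < (M - 1) / 2 by rewrite divr_gt0// subr_gt0.
have C1 : 0 < C + 1 by rewrite ltr_wpDl.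
exists (Num.min 1 ((M - 1) / 2 / (C + 1))).
  by rewrite lt_min ltr01 divr_gt0//= ge_min lexx.
exists (1 + (M - 1) / 2); first by rewrite ltrDl.
move=> x /andP[x0]; rewrite le_min => /andP[x1]; rewrite ler_pdivlMr// => xC.
have /andP[_] := @gf_tangent _ p p2 1 (1 - x) ltac:(lra) ltac:(lra).
rewrite gf1 gf_slope1 -/M -/C.
move: (mulr_ge0 x0 C0) => xC0; nra.
Qed.

Lemma gf_lt1 x : 0 <= x -> x < 1 -> gf p x < 1.
Proof.
move=> x0 x1; have [e /andP[e0 e1] [c c1 H]] := gf_repulsive.
have [xe|xe] := leP (1 - e) x.
  by have := H (1 - x) ltac:(lra); rewrite subKr; nra.
have := H e ltac:(lra); have := @le_gf _ p x (1 - e) x0 ltac:(lra) ltac:(lra).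
nra.
Qed.

Let qk k := iter k (gf p) 0.

Lemma iter_gf_bounds k : 0 <= qk k < 1.
Proof.
elim: k => [|k /andP[IH0 IH1]]; first by rewrite /qk/= lexx ltr01.
by rewrite /qk iterS gf_ge0// gf_lt1.
Qed.

Lemma iter_gf_nondecreasing : nondecreasing_seq qk.
Proof.
apply/nondecreasing_seqP; elim=> [|k IH]; first exact: gf_ge0.
have /andP[? ?] := iter_gf_bounds k; have /andP[? ?] := iter_gf_bounds k.+1.
by rewrite /qk [in leRHS]iterS [in leLHS]iterS; apply: le_gf => //; exact: ltW.
Qed.

Lemma iter_gf_le k : qk k <= q.
Proof.
have /cvg_lim <- // := q_lim.
by apply: nondecreasing_cvgn_le; [exact: iter_gf_nondecreasing|apply/cvg_ex; exists q].
Qed.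

Lemma fixpoint_gt0 : 0 < q.
Proof.
apply: lt_le_trans (iter_gf_le 1); rewrite /qk /= /gf.
by under eq_mean do rewrite expr0n; rewrite (mean_atom _ discrete_nat).
Qed.

(** If the limit were 1, the iterates would enter the repulsive neighbourhood of 1 at some index
    [K]; from there they cannot exceed [qk K], which is less than 1. *)
Lemma fixpoint_lt1 : q < 1.
Proof.
have q1 : q <= 1.
  have /cvg_lim <- // := q_lim; apply: limr_le; first by apply/cvg_ex; exists q.
  by near=> k; have /andP[_ /ltW] := iter_gf_bounds k.
rewrite lt_neqAle q1 andbT; apply/eqP => qE.
have [e /andP[e0 e1] [c c1 H]] := gf_repulsive.
have [K _ HK] : \forall k \near \oo, 1 - e <= qk k.
  have /cvgrPdist_le/(_ _ e0) := q_lim; apply: filterS => k.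
  by rewrite qE => /ler_normlP[_]; rewrite /qk; lra.
have HqK k : qk (k + K)%N <= qk K.
  elim: k => // k; rewrite addSn; have := HK (k + K)%N (leq_addl _ _).
  have /andP[? ?] := iter_gf_bounds (k + K).
  move=> h IH; have := H (1 - qk (k + K)) ltac:(lra).
  rewrite subKr [qk (k + K).+1]/qk iterS -/(qk _); nra.
have /andP[_] := iter_gf_bounds K; apply/negP; rewrite -leNgt -qE.
have /cvg_lim <- // := q_lim; apply: limr_le; first by apply/cvg_ex; exists q.
near=> k; rewrite -(@subnK K k) ?HqK//.
by near: k; exact: nbhs_infty_ge.
Unshelve. all: by end_near.
Qed.

Let q0 : 0 <= q. Proof. exact/ltW/fixpoint_gt0. Qed.
Let q1 : q <= 1. Proof. exact/ltW/fixpoint_lt1. Qed.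

Lemma gf_fixpoint : gf p q = q.
Proof.
apply: (@cvg_unique _ (@Rhausdorff R) (gf p (qk k) @[k --> \oo])).
  apply: gf_cvg => //; last by rewrite q0.
  by move=> k; have /andP[-> /ltW] := iter_gf_bounds k.
by have := q_lim; rewrite -(cvg_shiftS qk).
Qed.

(** If [gf p s >= s], the tangent at [s], compared with the fixed point [q], has slope at least 1;
    by convexity the graph is then on or above the diagonal at [1 - x], against the repulsion of
    1. *)
Lemma gf_lt s : q < s -> s < 1 -> gf p s < s.
Proof.
move=> qs s1; have [e /andP[e0 e1] [c c1 H]] := gf_repulsive.
pose x := Num.min ((1 - s) / 2) e.
have x0 : 0 < x by rewrite /x lt_min e0 andbT divr_gt0// subr_gt0.
have xe : x <= e by rewrite /x ge_min lexx orbT.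
have xs : x < 1 - s.
  by rewrite /x gt_min ltr_pdivrMr// ltr_pMr ?subr_gt0// (ltr_nat R 1 2).
have hx : 0 <= x <= e by rewrite ltW.
have cx : x < c * x by rewrite ltr_pMl.
have s01 : 0 <= s <= 1 by rewrite (le_trans q0 (ltW qs)) ltW.
have x01 : 0 <= 1 - x <= 1 by have := le_trans xe e1; clearbody x; lra.
have := H x hx; clearbody x.
have /andP[+ _] := gf_tangent p2 s01 x01.
have /andP[+ _] := @gf_tangent _ p p2 s q s01 ltac:(rewrite q0 q1//).
rewrite gf_fixpoint => h1 h2 h3; rewrite ltNge; apply/negP => h4.
have m1 : gf_slope p s * (s - q) >= (s - q) by lra.
have m1' : 1 <= gf_slope p s by rewrite -(ler_pM2r (x := s - q)) ?mul1r ?subr_gt0.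
have : 1 - x - s <= gf_slope p s * (1 - x - s) by rewrite ler_peMl//; lra.
lra.
Qed.

(** The tangent at [q] lies below the graph, which at the midpoint of [q] and 1 is strictly below
    the diagonal. *)
Lemma gf_slope_lt1 : gf_slope p q < 1.
Proof.
pose s := (q + 1) / 2; have ql := fixpoint_lt1; have qg := fixpoint_gt0.
have qs : q < s by rewrite /s; lra.
have s1 : s < 1 by rewrite /s; lra.
have /andP[+ _] := @gf_tangent _ p p2 q s ltac:(lra) ltac:(lra).
have := gf_lt qs s1; rewrite gf_fixpoint => h1 h2.
rewrite -(ltr_pM2r (x := s - q)) ?mul1r ?subr_gt0//; lra.
Qed.

Lemma gf_slope_fixpoint_gt0 : 0 < gf_slope p q.
Proof.
by apply: gf_slope_gt0 => //; [exact: lt_trans p1|rewrite fixpoint_gt0 q1].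
Qed.

End fixpoint.

(** * The step generating function *)

Lemma lipschitz_expr (R : realFieldType) (b x z : R) (k : nat) :
  1 <= b -> 0 <= x <= b -> 0 <= z <= b ->
  `|x ^+ k - z ^+ k| <= k%:R * b ^+ k * `|x - z|.
Proof.
move=> b1 /andP[x0 xb] /andP[z0 zb]; have b0 : 0 <= b by exact: le_trans b1.
elim: k => [|k IH]; first by rewrite !expr0 subrr normr0 !mul0r.
have -> : x ^+ k.+1 - z ^+ k.+1 = x * (x ^+ k - z ^+ k) + z ^+ k * (x - z).
  by rewrite !exprS; ring.
rewrite (le_trans (ler_normD _ _))// !normrM (ger0_norm x0) (ger0_norm (exprn_ge0 k z0)).
rewrite -natr1 exprS.
have bk : 0 <= b ^+ k by exact: exprn_ge0.
have zk : z ^+ k <= b * b ^+ k.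
  by rewrite -exprS (@le_trans _ _ (b ^+ k)) ?lerXn2r ?nnegrE// exprS ler_peMl.
have := ler_wpM2r (normr_ge0 (x - z)) zk.
have := ler_pM x0 (normr_ge0 _) xb IH.
nra.
Qed.

Section random_walk.
Context (R : realType) (a : probability int R).
Hypothesis a_integrable : summable a (fun y => y%:~R).
Hypothesis a_mean : mean a (fun y => y%:~R) = 0.
Hypothesis a_0 : mass a 0 < 1.
Hypothesis K_finite : forall s : R, 1 <= s -> summable a (fun y => s ^ y).
Let discZ := discrete_int.

Definition Kgf (s : R) : R := mean a (fun y => s ^ y).

Lemma summable_pos_part : summable a (fun y => Num.max 0 (y%:~R : R)).
Proof.
apply: (@summable_dom _ _ _ _ discZ _ (fun y => `|y%:~R : R|)).
  exact: (integrable_abse a_integrable).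
by move=> y; rewrite ger0_norm ?le_max ?lexx// ge_max normr_ge0 ler_norm.
Qed.

Lemma right_jump : exists y0 : nat, (0 < y0)%N /\ 0 < mass a y0%:Z.
Proof.
have s1 : summable a (fun y : int => (y == 0)%:R).
  by apply: (summable_bounded _ discZ (c := 1)) => y; case: eqP; rewrite ?normr0 ?normr1.
have sp := summable_pos_part.
(* The right-hand integrand is the absolute value of [y], which is at least 1 off 0. As [a] has mean
   zero, this reads [1 - mass a 0 <= 2 * E (max 0 y)]. *)
have H : mean a (fun y : int => 1 - (y == 0)%:R) <=
    mean a (fun y => 2 * Num.max 0 (y%:~R : R) - y%:~R).
  apply: le_mean.
  - by apply: summableB => //; exact: summable_cst.
  - by apply: summableB => //; exact: summableZ.
  move=> y; have [->|y0] := eqVneq y 0.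
    by rewrite maxxx !(subrr, mulr0).
  rewrite subr0; have [y1|y1] := ltP y 0.
    have y2 : (y%:~R : R) <= -1 by rewrite (_ : -1 = (- 1)%:~R) // ler_int; lia.
    by rewrite max_l; lra.
  have y2 : 1 <= (y%:~R : R) by rewrite (_ : 1 = 1%:~R) // ler_int; lia.
  by rewrite max_r; lra.
rewrite meanB ?mean_cst ?mean_atom// in H; last exact: summable_cst.
rewrite meanB ?meanZ// in H; last exact: summableZ.
rewrite a_mean in H.
have p0 y : 0 <= Num.max 0 (y%:~R : R) by rewrite le_max lexx.
have mp : 0 < mean a (fun y => Num.max 0 (y%:~R : R)) by move: a_0; lra.
have [z [z0 mz]] := mean_gt0_mass discZ sp p0 mp.
move: z0; rewrite lt_max ltxx/= ltr0z => z0.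
by exists `|z|%N; split; [lia|rewrite gez0_abs// ltW].
Qed.

Lemma Kgf1 : Kgf 1 = 1.
Proof. by rewrite /Kgf; under eq_mean do rewrite exp1rz; exact: mean_cst. Qed.

Lemma Kgf_lipschitz b : 1 <= b -> exists2 L : R, 0 <= L &
  forall u v, 1 <= u <= b -> 1 <= v <= b -> `|Kgf u - Kgf v| <= L * `|u - v|.
Proof.
(* One majorant for both signs: [k <= 2 ^ k] turns [k * b ^ k] into a power of [2 * b], and for
   negative exponents the inverses lie in the unit interval, so the exponent alone suffices. *)
move=> b1; pose F (y : int) : R := `|y%:~R| + (2 * b) ^ y.
have b2 : 1 <= 2 * b by lra.
have sF : summable a F.
  apply: summableD; first exact: (integrable_abse a_integrable).
  exact: K_finite.
exists (mean a F) => [|u v /andP[u1 ub] /andP[v1 vb]].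
  by apply: mean_ge0 => y; rewrite addr_ge0// exprz_ge0//; lra.
have pw y : `|u ^ y - v ^ y| <= `|u - v| * F y.
  rewrite mulrC; case: y => k.
    rewrite /F -!exprnP (le_trans (@lipschitz_expr _ b u v k b1 _ _)) ?ub ?vb ?andbT//; try lra.
    rewrite ler_wpM2r// exprMn ler_wpDl// ler_wpM2r ?exprn_ge0//; first lra.
    by rewrite -natrX ler_nat ltnW// ltn_expl.
  rewrite NegzE -!exprnN -!exprVn.
  have u' : 0 <= u^-1 <= 1 by rewrite invr_ge0 invf_le1; lra.
  have v' : 0 <= v^-1 <= 1 by rewrite invr_ge0 invf_le1; lra.
  rewrite (le_trans (@lipschitz_expr _ 1 _ _ k.+1 (lexx 1) u' v'))// expr1n mulr1.
  have -> : u^-1 - v^-1 = (v - u) * (u^-1 * v^-1) by field; rewrite !gt_eqF//; lra.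
  rewrite normrM (distrC v) ler_pM//.
    rewrite /F ler_wpDr ?exprz_ge0//; first lra.
    by rewrite mulrNz normrN -[leLHS]ger0_norm.
  rewrite ler_piMr// ger0_norm; move/andP: u' => [? ?]; move/andP: v' => [? ?].
    by rewrite mulr_ile1.
  exact: mulr_ge0.
rewrite /Kgf -meanB//; try exact: K_finite.
have sD : summable a (fun y => u ^ y - v ^ y) by apply: summableB; exact: K_finite.
rewrite mulrC -meanZ// ler_norml -[X in X <= _]mulN1r -meanZ; last exact: summableZ.
apply/andP; split; apply: le_mean => //; try exact: summableZ.
- by apply: summableZ; exact: summableZ.
- by move=> y; have /ler_normlP[+ _] := pw y; lra.
- by move=> y; have /ler_normlP[_] := pw y.
Qed.

Lemma exists_Kgf_eq (g : R) : 1 < g -> exists2 s : R, 1 < s & Kgf s = g.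
Proof.
move=> g1; have [y0 [y00 my]] := right_jump.
(* Large enough for the single atom at [y0 >= 1] to give [Kgf b >= g]. *)
pose b := g / mass a y0%:Z + 1.
have b1 : 1 <= b by rewrite lerDr divr_ge0 ?mass_ge0//; lra.
have Kb : g <= Kgf b.
  apply: le_trans (mass_le_mean discZ y0 (K_finite b1) _); last first.
    by move=> y; rewrite exprz_ge0//; lra.
  rewrite -ler_pdivrMr//; apply: (@le_trans _ _ b); first by rewrite lerDl.
  by rewrite -exprnP ler_eXnr//; lra.
have [L L0 HL] := Kgf_lipschitz b1.
(* The Lipschitz bound holds only between 1 and [b]; clamping extends it to the whole line, where
   continuity is easy to state for [IVT]. *)
pose clamp x := Num.max 1 (Num.min x b).
have clamp_itv x : 1 <= clamp x <= b.
  by rewrite le_max lexx/= ge_max b1 ge_min lexx orbT.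
have clamp_lip x z : `|clamp x - clamp z| <= `|x - z|.
  rewrite /clamp; have [h1|h1] := leP x b; have [h2|h2] := leP z b;
  rewrite ?(minEle,maxEle); repeat case: ifPn => ?; have := ler_norm (x - z);
  have := ler_norm (z - x); rewrite (distrC z x) ler_norml => ? ?; lra.
have [||c /itvP c1b Kc] := @IVT R (Kgf \o clamp) 1 b g b1.
- have Lp : 0 < L + 1 by lra.
  apply: continuous_subspaceT => x; apply/cvgrPdist_lt => e e0; near=> z.
  rewrite /= (le_lt_trans (HL _ _ (clamp_itv _) (clamp_itv _)))//.
  have : L * `|clamp x - clamp z| <= L * `|x - z| by rewrite ler_wpM2l.
  move/le_lt_trans; apply.
  have : `|x - z| < e / (L + 1).
    near: z; apply/nbhs_ballP; exists (e / (L + 1)) => //=.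
    exact: divr_gt0.
  rewrite ltr_pdivlMr//; have := normr_ge0 (x - z); nra.
- have c1 : clamp 1 = 1 by rewrite /clamp min_l// maxxx.
  have cb : clamp b = b by rewrite /clamp minxx max_r.
  by rewrite /= c1 cb Kgf1 ge_min (ltW g1)/= le_max Kb orbT.
have cE : clamp c = c by rewrite /clamp min_l ?max_r ?c1b.
rewrite /= cE in Kc; exists c => //.
rewrite lt_neqAle c1b andbT; apply/eqP => c1; rewrite -c1 Kgf1 in Kc.
by rewrite Kc ltxx in g1.
Unshelve. all: by end_near.
Qed.

Lemma step_gfE s : 1 <= s -> step_gf a s = (Kgf s)%:E.
Proof.
by move=> s1; rewrite /step_gf unlock mean_integral//; exact: K_finite.
Qed.

Lemma rhoP (g : R) : 1 < g -> 1 < rho a g /\ Kgf (rho a g) = g.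
Proof.
move=> g1; have [s s1 Ks] := exists_Kgf_eq g1.
(* A solution exists, so [xget] does not fall back on its default value 0. *)
have [r1 rE] : [set s | 1 < s /\ step_gf a s = g%:E] (rho a g).
  by apply: xgetPex; exists s; split => //; rewrite step_gfE ?Ks// ltW.
split=> //; rewrite step_gfE ?(ltW r1)// in rE.
by case: rE.
Qed.

Lemma expr_exprz (s : R) (j : nat) (y : int) : (s ^+ j) ^ y = (s ^ y) ^+ j.
Proof. by rewrite !exprnP !exprz_exp mulrC. Qed.

(** The variance of [s ^ y] is nonnegative. This provides the gain [m * Kgf a (r ^+ 2) > 1] in
    [tail_lower]. *)
Lemma Kgf_sqr s : 1 <= s -> Kgf s ^+ 2 <= Kgf (s ^+ 2).
Proof.
move=> s1; set k := Kgf s.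
have s2 : 1 <= s ^+ 2 by rewrite expr_ge1//; lra.
have sk1 := K_finite s1; have sk2 := K_finite s2.
have skc : summable a (fun=> k ^+ 2) by exact: summable_cst.
have skZ := summableZ (2 * k) sk1; have skB := summableB skZ skc.
have := @mean_ge0 _ _ _ a (fun y => (s ^+ 2) ^ y - (2 * k * s ^ y - k ^+ 2)).
rewrite meanB// meanB// meanZ// mean_cst -/(Kgf _) -/(Kgf _) -/k.
move=> H; suff : 0 <= Kgf (s ^+ 2) - (2 * k * k - k ^+ 2) by nra.
apply: H => y; rewrite expr_exprz.
by have := sqr_ge0 (s ^ y - k); nra.
Qed.

End random_walk.

(** * Asymptotics of the recursion *)

Section maximum_principle.
Context (R : realType) (a : probability int R) (m : R).
Hypothesis m01 : 0 < m < 1.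

Lemma maximum_principle (D : int -> R) (b : R) : (forall n, D n <= b) ->
  (forall s, 0 <= s -> (forall n, D n <= s) -> forall n, D n <= m * s) ->
  forall n, D n <= 0.
Proof.
move=> Db step n; have /andP[m0 m1] := m01; pose c := Num.max 0 b.
have c0 : 0 <= c by rewrite le_max lexx.
have H k : forall j, D j <= m ^+ k * c.
  elim: k => [|k IH] j.
    by rewrite expr0 mul1r (le_trans (Db j))// le_max lexx orbT.
  by rewrite exprS -mulrA; apply: step => //; rewrite mulr_ge0// exprn_ge0// ltW.
have Hc : (fun k => m ^+ k * c) @ \oo --> (0 : R).
  rewrite -(mul0r c); apply: cvgMl; apply: cvg_expr; rewrite ger0_norm//; exact: ltW.
have /cvg_lim <- // := Hc; apply: limr_ge; first by apply/cvg_ex; exists 0.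
by near=> k.
Unshelve. all: by end_near.
Qed.

End maximum_principle.

Section tail_asymptotics.
Context (R : realType) (a : probability int R) (q m C r : R).
Context (phi : R -> R) (h : int -> R).
Let discZ := discrete_int.
Let x_ (n : int) : R := r ^ (- n).
Hypothesis q0 : 0 < q.
Hypothesis m01 : 0 < m < 1.
Hypothesis C0 : 0 <= C.
Hypothesis r1 : 1 < r.
Hypothesis K_finite : forall s : R, 1 <= s -> summable a (fun y => s ^ y).
Hypothesis K_r : m * Kgf a r = 1.
Hypothesis phi0 : phi 0 = 0.
Hypothesis phi_incr : forall x y, 0 <= x -> x <= y -> y <= q -> phi x <= phi y.
Hypothesis phi_lip : forall x y, 0 <= x -> x <= y -> y <= q ->
  phi y - phi x <= m * (y - x).
Hypothesis phi_lower : forall x, 0 <= x <= q -> m * x - C * x ^+ 2 <= phi x.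
Hypothesis h_itv : forall n, 0 <= h n <= q.
Hypothesis h_left : forall n : int, n <= 0 -> h n = q.
Hypothesis h_decr : forall n k : int, n <= k -> h k <= h n.
Hypothesis h_rec : forall n : int, 0 < n ->
  h n = mean a (fun y => phi (h (n - y))).

Let m0 : 0 < m. Proof. by case/andP: m01. Qed.
Let m1 : m < 1. Proof. by case/andP: m01. Qed.
Let r0 : 0 < r. Proof. exact: lt_trans r1. Qed.

Lemma phi_itv x : 0 <= x <= q -> 0 <= phi x <= m * x.
Proof.
move=> /andP[x0 xq]; rewrite -{1}phi0 phi_incr//=.
by have := phi_lip (lexx 0) x0 xq; rewrite phi0 !subr0.
Qed.

Lemma summable_phi (g : int -> R) : (forall n, 0 <= g n <= q) ->
  summable a (fun y => phi (g y)).
Proof.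
move=> g_itv; apply: (summable_bounded _ discZ (c := m * q)) => y.
have /andP[p0 pm] := phi_itv (g_itv y); have /andP[_ gq] := g_itv y.
by rewrite ger0_norm// (le_trans pm)// ler_wpM2l// ltW.
Qed.

Lemma decay_gt0 n : 0 < x_ n. Proof. exact: exprz_gt0. Qed.

Lemma decayB n y : x_ (n - y) = x_ n * r ^ y.
Proof. by rewrite /x_ opprB addrC expfzDr// gt_eqF. Qed.

Lemma decay_decr n k : n <= k -> x_ k <= x_ n.
Proof. by move=> nk; rewrite /x_ ler_weXz2l ?lerN2// ltW. Qed.

Lemma summable_expz j : summable a (fun y => (r ^ y) ^+ j).
Proof.
have := @K_finite (r ^+ j); under eq_fun do rewrite expr_exprz.
by apply; rewrite exprn_ege1// ltW.
Qed.

(** Since [m * Kgf a r = 1], the function [q * x_ n] solves the linearised recursion exactly, and it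
    dominates [h n = q] for [n <= 0] because [x_ n >= 1] there. *)
Lemma tail_upper n : h n <= q * x_ n.
Proof.
rewrite -subr_le0; move: n.
apply: (maximum_principle m01 (b := q)) => [n|s s0 Ds n].
  rewrite lerBlDr (le_trans _ (_ : q <= _))//; first by case/andP: (h_itv n).
  by rewrite lerDl mulr_ge0// ltW// decay_gt0.
have [n0|n0] := leP n 0.
  rewrite h_left// (@le_trans _ _ 0) ?mulr_ge0 ?(ltW m0)//.
  by rewrite subr_le0 ler_peMr ?(ltW q0)// /x_ -(expr0z r) ler_weXz2l ?oppr_ge0// ltW.
have sr : summable a (fun y => r ^ y) by apply: K_finite; exact: ltW.
rewrite h_rec// lerBlDr.
have -> : m * s + q * x_ n = mean a (fun y => m * s + (m * q * x_ n) * r ^ y).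
  rewrite meanD ?mean_cst ?meanZ//; last 2 first.
    exact: summable_cst.
    exact: summableZ.
  rewrite -/(Kgf a r); ring: K_r.
apply: le_mean.
- by apply: summable_phi.
- by apply: summableD; [exact: summable_cst|exact: summableZ].
move=> y; have /andP[_ +] := phi_itv (h_itv (n - y)); move/le_trans; apply.
rewrite -!mulrA -mulrDr ler_wpM2l ?(ltW m0)//.
by have := Ds (n - y); rewrite decayB; lra.
Qed.

Lemma phi_gt0 x : 0 < x <= q -> 0 < phi x.
Proof.
(* At [z] the quadratic error is at most half of [m * z]; monotonicity then leads back to [x]. *)
move=> /andP[x0 xq]; pose z := Num.min x (m / (2 * (C + 1))).
have C1 : 0 < 2 * (C + 1) by rewrite mulr_gt0// ltr_wpDl.
have z0 : 0 < z by rewrite lt_min x0 divr_gt0.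
have zx : z <= x by rewrite ge_min lexx.
have zm : z * (2 * (C + 1)) <= m by rewrite -ler_pdivlMr// ge_min lexx orbT.
apply: lt_le_trans (phi_incr (ltW z0) zx xq).
apply: lt_le_trans (phi_lower _); last by rewrite (ltW z0) (le_trans zx).
have := mulr_ge0 C0 (ltW z0); nra.
Qed.

(** Positivity spreads to the right: the charged jump [y0 >= 1] relates [k + 1] to a site not beyond
    [k]. *)
Lemma tail_gt0 (y0 : nat) : (0 < y0)%N -> 0 < mass a y0%:Z ->
  forall n, 0 < h n.
Proof.
move=> y00 my n; suff H (k : nat) : 0 < h k%:Z.
  apply: lt_le_trans (H `|n|%N) (h_decr _); clear; lia.
elim: k => [|k IH]; first by rewrite h_left.
rewrite h_rec//.
have s := @summable_phi (fun y => h (k.+1%:Z - y)) (fun y => h_itv _).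
apply: lt_le_trans (mass_le_mean discZ y0%:Z s _); last first.
  by move=> y; case/andP: (phi_itv (h_itv (k.+1%:Z - y))).
rewrite mulr_gt0// phi_gt0//; have /andP[_ ->] := h_itv (k.+1%:Z - y0%:Z).
by rewrite andbT (lt_le_trans IH)// h_decr//; move: y00; clear; lia.
Qed.

(* With [x = r ^ (- n)], the function [e * (min x 1 + (min x 1) ^ 2)] is a
   subsolution of the recursion for large [n]: the gain [m * K(r ^ 2) - 1 > 0]
   on the quadratic term absorbs both the quadratic error of [phi] and, through
   [x + x ^ 2 - 2 * x ^ 3 <= min x 1 + (min x 1) ^ 2], the overshoots. *)
Lemma tail_lower : (forall n, 0 < h n) -> exists2 e : R, 0 < e &
  exists n1 : nat, forall n : nat, (n1 <= n)%N -> e * x_ n%:Z <= h n%:Z.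
Proof.
move=> h_gt0.
pose K2 := Kgf a (r ^+ 2); pose K3 := Kgf a (r ^+ 3).
have r2 : 1 <= r ^+ 2 by rewrite exprn_ege1// ltW.
have r3 : 1 <= r ^+ 3 by rewrite exprn_ege1// ltW.
have K30 : 0 <= K3 by apply: mean_ge0 => y; rewrite exprz_ge0// (le_trans _ r3).
have K20 : 0 <= K2 by apply: mean_ge0 => y; rewrite exprz_ge0// (le_trans _ r2).
have mK2 : 1 < m * K2.
  have : Kgf a r ^+ 2 <= K2 by apply: Kgf_sqr => //; exact: ltW.
  have Kr : 1 < Kgf a r by rewrite -(ltr_pM2l m0) K_r mulr1.
  move: K_r m0; nra.
pose d := m * K2 - 1; have d0 : 0 < d by rewrite subr_gt0.
(* From [n1] on, the cubic loss [2 * m * K3 * x_ n] uses at most half of the gain [d]. *)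
have [n1 n1P] : exists n1 : nat, (0 < n1)%N /\ 4 * m * K3 * x_ n1%:Z <= d.
  have Hc : (fun n : nat => 4 * m * K3 * r^-1 ^+ n) @ \oo --> (0 : R).
    rewrite -(mulr0 (4 * m * K3)); apply: cvgMr; apply: cvg_expr.
    by rewrite ger0_norm ?invr_ge0 ?(ltW r0)// invf_lt1.
  have /cvgrPdist_le/(_ _ d0)[n1 _ Hn1] := Hc.
  exists n1.+1; split => //; have := Hn1 n1.+1 (leqnSn _).
  by rewrite sub0r normrN /x_ -exprnN -exprVn => /ler_normlP[_].
(* The three bounds give [g <= h] to the left of [n1], keep [g] in the domain of [phi], and let the
   quadratic error use at most the other half of [d]. *)
pose e := Num.min (Num.min (h n1%:Z / 2) (q / 2)) (d / (8 * (C * K2 + 1))).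
have CK : 0 <= C * K2 by rewrite mulr_ge0.
have CK1 : 0 < 8 * (C * K2 + 1) by rewrite mulr_gt0// ltr_wpDl.
have e0 : 0 < e by rewrite !lt_min !divr_gt0.
have eh : 2 * e <= h n1%:Z.
  by rewrite mulrC -ler_pdivlMr// !ge_min lexx.
have eq : 2 * e <= q by rewrite mulrC -ler_pdivlMr// !ge_min lexx orbT.
have ed : 8 * (C * K2 + 1) * e <= d.
  by rewrite mulrC -ler_pdivlMr// ge_min lexx orbT.
clearbody e; exists e => //; exists n1.
pose t n := Num.min (x_ n) 1.
have t0 n : 0 < t n by rewrite lt_min decay_gt0 ltr01.
have t1 n : t n <= 1 by rewrite ge_min lexx orbT.
have tx n : t n <= x_ n by rewrite ge_min lexx.
pose g n := e * (t n + t n ^+ 2).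
have g0 n : 0 <= g n by rewrite mulr_ge0 ?(ltW e0)// addr_ge0 ?sqr_ge0// ltW.
have g2 n : g n <= 2 * e.
  rewrite /g mulrC ler_wpM2r ?(ltW e0)//.
  by have := t0 n; have := t1 n; generalize (t n) => z; nra.
have g_itv n : 0 <= g n <= q by rewrite g0 (le_trans (g2 n)).
have g_phi n : e * m * (x_ n + x_ n ^+ 2 - 2 * x_ n ^+ 3) -
    4 * C * e ^+ 2 * x_ n ^+ 2 <= phi (g n).
  apply: le_trans (phi_lower (g_itv n)); apply: lerB.
    rewrite /g (mulrA m) (mulrC m) ler_wpM2l ?mulr_ge0 ?(ltW e0) ?(ltW m0)//.
    have := decay_gt0 n; rewrite /t; generalize (x_ n) => z.
    have [h1 ?|h1 ?] := leP z 1; last by nra.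
    by rewrite gerBl mulr_ge0// exprn_ge0// ltW.
  rewrite (_ : 4 * C * e ^+ 2 * x_ n ^+ 2 = C * (2 * e * x_ n) ^+ 2); last by ring.
  rewrite ler_wpM2l// lerXn2r ?nnegrE// /g ?mulr_ge0 ?(ltW e0) ?(ltW (decay_gt0 n))//.
  have : t n + t n ^+ 2 <= 2 * x_ n.
    by have := t0 n; have := t1 n; have := tx n; generalize (t n) (x_ n) => z w; nra.
  by move/(ler_wpM2l (ltW e0)); lra.
suff D0 n : g n - h n <= 0.
  move=> n nn1; have := D0 n; rewrite subr_le0; apply: le_trans.
  rewrite ler_wpM2l ?(ltW e0)//.
  have xn1 : x_ n%:Z <= 1.
    by rewrite /x_ -(expr0z r) ler_weXz2l ?(ltW r1)// oppr_le0.
  by rewrite /t min_l// lerDl sqr_ge0.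
move: n; apply: (maximum_principle m01 (b := 2 * e)) => [n|s s0 Ds n].
  by rewrite (le_trans _ (g2 n))// gerBl; case/andP: (h_itv n).
have [nn1|nn1] := ltP n n1%:Z.
  rewrite (@le_trans _ _ 0) ?mulr_ge0 ?(ltW m0)// subr_le0.
  by rewrite (le_trans (g2 n))// (le_trans eh)// h_decr// ltW.
have n0 : 0 < n by apply: lt_le_trans nn1; rewrite ltz_nat; case: n1P.
have sg := @summable_phi (fun y => g (n - y)) (fun y => g_itv _).
have sh := @summable_phi (fun y => h (n - y)) (fun y => h_itv _).
have gn : g n <= mean a (fun y => phi (g (n - y))).
  have sx j := summable_expz j.
  pose c1 := e * m * x_ n.
  pose c2 := e * m * x_ n ^+ 2 - 4 * C * e ^+ 2 * x_ n ^+ 2.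
  pose c3 := - (2 * e * m * x_ n ^+ 3).
  have szZ c j : summable a (fun y => c * (r ^ y) ^+ j) by exact: summableZ.
  apply: (@le_trans _ _ (mean a (fun y =>
    c1 * (r ^ y) ^+ 1 + c2 * (r ^ y) ^+ 2 + c3 * (r ^ y) ^+ 3))); last first.
    apply: le_mean => //; first by apply: summableD => //; exact: summableD.
    move=> y; apply: le_trans (g_phi (n - y)); rewrite decayB /c1 /c2 /c3.
    by rewrite le_eqVlt; apply/orP; left; apply/eqP; ring.
  rewrite meanD ?meanD//; last exact: summableD.
  rewrite !meanZ//.
  have E j : mean a (fun y => (r ^ y) ^+ j) = Kgf a (r ^+ j).
    by apply: eq_mean => y; rewrite expr_exprz.
  rewrite !E expr1 -/K2 -/K3.
  have xn : x_ n <= x_ n1%:Z by exact: decay_decr.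
  have xn0 := decay_gt0 n.
  have H : 4 * m * K3 * x_ n <= d.
    by apply: le_trans n1P.2; rewrite ler_wpM2l// !mulr_ge0// ltW.
  have -> : c1 * Kgf a r = e * x_ n by rewrite /c1 mulrAC -(mulrA e) K_r; ring.
  have gx : g n <= e * (x_ n + x_ n ^+ 2).
    rewrite ler_wpM2l ?(ltW e0)// lerD ?tx// lerXn2r ?nnegrE ?tx// ltW//.
  apply: (le_trans gx); rewrite -addrA mulrDr lerD2l /c2 /c3.
  have -> : (e * m * x_ n ^+ 2 - 4 * C * e ^+ 2 * x_ n ^+ 2) * K2 +
    - (2 * e * m * x_ n ^+ 3) * K3 =
    e * x_ n ^+ 2 * (1 + d - 4 * (C * K2) * e - 2 * m * K3 * x_ n).
    rewrite /d; ring.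
  by rewrite ler_peMr ?mulr_ge0 ?sqr_ge0 ?(ltW e0)//; move: CK e0 ed; nra.
rewrite (h_rec n0) lerBlDr (le_trans gn)//.
rewrite -(mean_cst a (m * s)) -meanD//; last exact: summable_cst.
apply: le_mean => //.
  by apply: summableD => //; exact: summable_cst.
move=> y; have /andP[gy0 gyq] := g_itv (n - y); have /andP[hy0 hyq] := h_itv (n - y).
(* Where [g <= h], monotonicity of [phi] suffices; the contraction by [m] is used only where [g]
   exceeds [h]. *)
have [gh|hg] := leP (g (n - y)) (h (n - y)).
  by rewrite (le_trans (phi_incr gy0 gh hyq))// lerDr mulr_ge0// ltW.
rewrite -lerBlDr (le_trans (phi_lip hy0 (ltW hg) gyq))//.
by rewrite ler_wpM2l// ltW.
Qed.

(* Right jumps are at most [R0], so a walk coming down from above [k] enters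
   [(-oo, k]] within the window [[k - R0, k]]. *)
Lemma scaled_upper (c : R) (k R0 : int) :
  (forall y : int, R0 < y -> mass a y = 0) -> 0 <= c ->
  (forall j, k - R0 <= j -> j <= k -> h j <= c * x_ j) -> 0 <= k ->
  forall n, k <= n -> h n <= c * x_ n.
Proof.
move=> a_right c0 hc k0.
(* Left of the window no bound is available, so [D] is set to 0 up to [k]. A charged [y] sends a
   site [n > k] to [n - y], which is beyond [k] or in the window. *)
pose D n := if k < n then h n - c * x_ n else 0.
have D0 : forall n, D n <= 0.
  apply: (maximum_principle m01 (b := q)) => [n|s s0 Ds n]; rewrite {1}/D.
    case: ifP => _; last exact: ltW.
    have := mulr_ge0 c0 (ltW (decay_gt0 n)).
    by have /andP[_] := h_itv n; lra.
  case: ifP => kn; last by rewrite mulr_ge0// ltW.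
  rewrite h_rec; last exact: le_lt_trans kn.
  have sr : summable a (fun y => r ^ y) by apply: K_finite; exact: ltW.
  rewrite lerBlDr.
  have -> : m * s + c * x_ n = mean a (fun y => m * s + (m * c * x_ n) * r ^ y).
    rewrite meanD ?mean_cst ?meanZ//; last 2 first.
      exact: summable_cst.
      exact: summableZ.
    rewrite -/(Kgf a r); ring: K_r.
  apply: le_mean_mass => //.
  - by apply: summable_phi.
  - by apply: summableD; [exact: summable_cst|exact: summableZ].
  move=> y my; have yR : y <= R0.
    by rewrite leNgt; apply/negP => /a_right my0; rewrite my0 ltxx in my.
  have /andP[_ +] := phi_itv (h_itv (n - y)); move/le_trans; apply.
  rewrite -!mulrA -mulrDr ler_wpM2l ?(ltW m0)// -decayB.
  have [kny|kny] := ltP k (n - y).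
    by have := Ds (n - y); rewrite /D kny; lra.
  apply: le_trans (hc _ _ kny) _; last by rewrite lerDr.
  by rewrite lerB// ltW.
move=> n; rewrite le_eqVlt => /orP[/eqP <-|kn].
  apply: hc => //; have [//|kR] := lerP (k - R0) k.
  (* An empty window is impossible: all charged jumps would be negative, so that [Kgf a r <= 1],
     against [m * Kgf a r = 1] and [m < 1]. *)
  have R0neg : R0 < 0 by lia.
  have K0 : mean a (fun y => r ^ y) <= mean a (fun y => 1).
    apply: le_mean_mass => //; [|exact: summable_cst|].
      by apply: K_finite; exact: ltW.
    move=> y my; have yR : y <= R0.
      by rewrite leNgt; apply/negP => /a_right my0; rewrite my0 ltxx in my.
    by rewrite -(expr0z r) ler_weXz2l ?(ltW r1)//; lia.
  move: K0; rewrite mean_cst -/(Kgf a r) => K0.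
  by have := ler_wpM2l (ltW m0) K0; rewrite K_r mulr1 leNgt m1.
by have := D0 n; rewrite /D kn subr_le0.
Qed.

(* If [r ^ n * h n] is close to its lower limit [l] at some large [n], then so
   it is on all of [[n - R0, n]], because [a] charges [1, ..., R0]; by
   [scaled_upper] it then stays below [l + e] from there on. *)
Lemma tail_limit (R0 : nat) : (0 < R0)%N ->
  (forall y : int, R0%:Z < y -> mass a y = 0) ->
  (forall i : nat, (1 <= i <= R0)%N -> 0 < mass a i%:Z) ->
  exists l : R, (fun n : nat => r ^+ n * h n%:Z) @ \oo --> l.
Proof.
move=> R00 a_right a_pos; pose H (n : nat) := r ^+ n * h n%:Z.
have rn n : 0 < r ^+ n by exact: exprn_gt0.
have xr (n : nat) : x_ n%:Z = (r ^+ n)^-1 by rewrite /x_ -exprnN.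
have hH (n : nat) : h n%:Z = H n * x_ n%:Z by rewrite /H xr mulrC mulKf// gt_eqF.
have H0 n : 0 <= H n by rewrite mulr_ge0 ?(ltW (rn n))//; case/andP: (h_itv n%:Z).
have Hq n : H n <= q.
  by rewrite /H mulrC -ler_pdivlMr// -xr; exact: tail_upper.
(* The eventual lower bounds of [H]; their supremum [l] is the lower limit. *)
pose L := [set x | exists M : nat, forall n, (M <= n)%N -> x <= H n].
have L0 : L 0 by exists 0%N.
have Lub : ubound L q by move=> x [M HM]; exact: le_trans (HM M (leqnn M)) (Hq M).
have Lsup : has_sup L by split; [exists 0|exists q].
pose l := sup L.
have l0 : 0 <= l by apply: sup_ubound L0; exists q.
have l_lower e : 0 < e -> exists M : nat, forall n, (M <= n)%N -> l - e <= H n.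
  move=> e0; have [x [M HM] xl] := sup_adherent e0 Lsup.
  by exists M => n /HM; apply: le_trans; exact: ltW.
have l_upper e M : 0 < e -> exists n : nat, (M <= n)%N /\ H n <= l + e.
  move=> e0; apply: contrapT => /forallNP Hn.
  have : L (l + e).
    by exists M => n Mn; have [//|/ltW Hle] := leP (l + e) (H n); case: (Hn n).
  by move/(sup_ubound Lsup.2); rewrite -/l; lra.
have [al al0 alP] : exists2 al : R, 0 < al &
    forall i : nat, (1 <= i <= R0)%N -> al <= m * mass a i%:Z.
  clear -a_pos m0; elim: R0 a_pos => [|k IH] a_pos.
    by exists 1 => // i; case: i.
  have [|al al0 alP] := IH.
    by move=> i /andP[i1 ik]; apply: a_pos; rewrite i1 leqW.
  exists (Num.min al (m * mass a k.+1%:Z)).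
    by rewrite lt_min al0 mulr_gt0// a_pos/= ?leqnn.
  move=> i /andP[i1]; rewrite leq_eqVlt => /orP[/eqP ->|ik].
    by rewrite ge_min lexx orbT.
  by rewrite ge_min alP// i1.
exists l; apply/cvgrPdist_le => e e0.
pose K2 := Kgf a (r ^+ 2).
have r2 : 1 <= r ^+ 2 by rewrite exprn_ege1// ltW.
have K20 : 0 <= K2 by apply: mean_ge0 => y; rewrite exprz_ge0// (le_trans _ r2).
(* Solves [3 * d / al + d = e], where [3 * d / al] is the excess over [l] allowed on the window by
   [near_l]. *)
pose d := e / (3 / al + 1).
have al3 : 0 < 3 / al + 1 by rewrite ltr_wpDl// divr_ge0// ltW.
have d0 : 0 < d by rewrite divr_gt0.
have dE : 3 * d / al + d = e by rewrite /d; field; rewrite !gt_eqF//; lra.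
have [M HM] := l_lower d d0.
have [M' HM'] : exists M' : nat, forall n, (M' <= n)%N ->
    C * q ^+ 2 * K2 * x_ n%:Z <= d.
  have Hc : (fun n : nat => C * q ^+ 2 * K2 * r^-1 ^+ n) @ \oo --> (0 : R).
    rewrite -(mulr0 (C * q ^+ 2 * K2)); apply: cvgMr; apply: cvg_expr.
    by rewrite ger0_norm ?invr_ge0 ?(ltW r0)// invf_lt1.
  have /cvgrPdist_le/(_ _ d0)[M' _ HM'] := Hc.
  exists M' => n /HM'; rewrite sub0r normrN xr -exprVn => /ler_normlP[_]//.
(* [M + R0] keeps every [n - y] with [y <= R0] where [H >= l - d]; [M'] makes the quadratic error at
   most [d]. *)
have [n [nM Hn]] := l_upper d (M + R0 + M')%N d0.
have HM'n : C * q ^+ 2 * K2 * x_ n%:Z <= d by apply: HM'; move: nM; clear; lia.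
have n0 : 0 < n%:Z by move: R00 nM; clear; lia.
have near_l (i : nat) : (1 <= i <= R0)%N -> H (n - i)%N <= l + 3 * d / al.
  move=> iR; have i_le : (i <= n)%N by move: nM iR; clear; lia.
  have sh := @summable_phi (fun y => h (n%:Z - y)) (fun y => h_itv _).
  have sx j := summable_expz j.
  (* The excess at [n - i] over the common lower bound [l - d]. The recursion at [n] gives
     [l + d >= H n >= l - d + u * al - d], hence [u * al <= 3 * d]. *)
  pose u := H (n - i)%N - (l - d).
  have u0 : 0 <= u by rewrite subr_ge0 HM//; move: nM iR; clear; lia.
  have s0 : summable a (fun y : int => (y == i%:Z)%:R).
    by apply: (summable_bounded _ discZ (c := 1)) => y; case: eqP; rewrite ?normr0 ?normr1.
  pose c1 := m * (l - d) * x_ n%:Z.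
  pose c2 := m * u * x_ (n - i)%N%:Z.
  pose c3 := - (C * q ^+ 2 * x_ n%:Z ^+ 2).
  have : mean a (fun y => c1 * (r ^ y) ^+ 1 + c2 * (y == i%:Z)%:R + c3 * (r ^ y) ^+ 2)
      <= h n%:Z.
    rewrite h_rec//; apply: le_mean_mass => //.
      by apply: summableD; [apply: summableD|]; exact: summableZ.
    move=> y my; have yR : y <= R0%:Z.
      by rewrite leNgt; apply/negP => /a_right my0; rewrite my0 ltxx in my.
    apply: le_trans (phi_lower (h_itv _)); rewrite /c3 mulNr; apply: lerB; last first.
      have -> : C * q ^+ 2 * x_ n%:Z ^+ 2 * (r ^ y) ^+ 2 =
        C * (q * x_ (n%:Z - y)) ^+ 2 by rewrite decayB; ring.
      rewrite ler_wpM2l// lerXn2r ?tail_upper// nnegrE.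
        by case/andP: (h_itv (n%:Z - y)).
      by rewrite mulr_ge0 ?ltW// decay_gt0.
    have -> : c1 * (r ^ y) ^+ 1 = m * ((l - d) * x_ (n%:Z - y)).
      by rewrite decayB /c1; ring.
    rewrite /c2 -!mulrA -mulrDr ler_wpM2l ?(ltW m0)//.
    have [->|yi] := eqVneq y i%:Z.
      by rewrite mulr1 (_ : n%:Z - i%:Z = (n - i)%N%:Z) ?subzn// hH /u; lra.
    rewrite !mulr0 addr0.
    have yn : M%:Z <= n%:Z - y by move: yR nM; clear; lia.
    have -> : n%:Z - y = `|n%:Z - y|%N%:Z by move: yn; clear; lia.
    by rewrite hH ler_wpM2r ?(ltW (decay_gt0 _))// HM//; move: yn; clear; lia.
  rewrite meanD ?meanD//; [|exact: summableZ..|apply: summableD|]; try exact: summableZ.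
  rewrite !meanZ// mean_atom//.
  have E j : mean a (fun y => (r ^ y) ^+ j) = Kgf a (r ^+ j).
    by apply: eq_mean => y; rewrite expr_exprz.
  rewrite !E expr1 -/K2 hH.
  have -> : c1 * Kgf a r = (l - d) * x_ n%:Z.
    by rewrite /c1; ring: K_r.
  have xi : x_ (n - i)%N%:Z = x_ n%:Z * r ^+ i.
    by rewrite -subzn// decayB.
  have -> : (l - d) * x_ n%:Z + c2 * mass a i%:Z + c3 * K2 =
    (l - d + u * (m * mass a i%:Z * r ^+ i) - C * q ^+ 2 * K2 * x_ n%:Z) * x_ n%:Z.
    by rewrite /c2 /c3 xi; ring.
  rewrite ler_pM2r ?decay_gt0// => Hle.
  have ua : u * al <= u * (m * mass a i%:Z * r ^+ i).
    rewrite ler_wpM2l// (le_trans (alP _ iR))// ler_peMr//.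
      by rewrite mulr_ge0 ?(ltW m0)// mass_ge0.
    by rewrite exprn_ege1// ltW.
  have : u <= 3 * d / al by rewrite ler_pdivlMr//; lra.
  by rewrite /u; lra.
have al3' : 0 <= 3 * d / al.
  by apply: divr_ge0; [apply: mulr_ge0 => //; exact: ltW|exact: ltW].
have final (j : nat) : (n <= j)%N -> H j <= l + e.
  move=> nj; rewrite /H mulrC -ler_pdivlMr// -xr.
  have le0 : 0 <= l + e by apply: addr_ge0 => //; exact: ltW.
  apply: (scaled_upper a_right le0 _ (ltW n0)) => //.
  move=> k nk kn; have k0 : 0 <= k by move: nk nM; clear; lia.
  have -> : k = `|k|%N%:Z by move: k0; clear; lia.
  rewrite hH ler_wpM2r ?(ltW (decay_gt0 _))//.
  have [kE|kn'] := eqVneq k n%:Z.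
    by rewrite kE/= (le_trans Hn)// lerD2l -dE lerDr.
  have -> : `|k|%N = (n - (n - `|k|))%N by move: k0 kn; clear; lia.
  rewrite (le_trans (near_l _ _))//; first by move: k0 kn nk kn'; clear; lia.
  by rewrite lerD2l -dE lerDl ltW.
near=> j; have lj : l - d <= H j.
  by apply: HM; near: j; exact: nbhs_infty_ge.
have jl : H j <= l + e by apply: final; near: j; exact: nbhs_infty_ge.
have de : d <= e by rewrite -dE lerDr.
by rewrite ler_norml; apply/andP; split; rewrite -/(H j); lra.
Unshelve. all: by end_near.
Qed.

End tail_asymptotics.

(** * Surviving populations are unbounded to the right *)

Section window_sum.
Context (R : realFieldType) (g : int -> R).
Hypothesis g_ge0 : forall n, 0 <= g n.
Hypothesis g_decr : forall n k : int, n <= k -> g k <= g n.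

Let window (b : int) (k : nat) (y : int) := \sum_(0 <= i < k) g (b + i%:Z - y).

Let windowS b k y : window b k (y + 1) =
  window b k y + g (b - y - 1) - g (b + k%:Z - y - 1).
Proof.
pose F (i : nat) := g (b - y - 1 + i%:Z).
have E1 : window b k (y + 1) = \sum_(0 <= i < k) F i.
  by apply: eq_bigr => i _; congr g; ring.
have E2 : window b k y = \sum_(0 <= i < k) F i.+1.
  by apply: eq_bigr => i _; congr g; rewrite intS; ring.
have := telescope_sumr F (leq0n k); rewrite sumrB -E1 -E2 /F addr0.
have -> : b - y - 1 + k%:Z = b + k%:Z - y - 1 by ring.
lra.
Qed.

(** For [y > 0] the shifted window gains [y] terms at the left end, each at least [g b], and loses
    [y] terms at the right end, each at most [g (b + k - y)]. For [y < 0] the lost terms are at most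
    [g b], and the gain at the right end is dropped. *)
Lemma window_shift (b : int) (k : nat) (y : int) :
  \sum_(0 <= i < k) g (b + i%:Z) + y%:~R * g b -
    Num.max 0 (y%:~R) * g (b + k%:Z - y) <=
  \sum_(0 <= i < k) g (b + i%:Z - y).
Proof.
have -> : \sum_(0 <= i < k) g (b + i%:Z) = window b k 0.
  by apply: eq_bigr => i _; rewrite subr0.
rewrite -/(window b k y); case: y => j.
  rewrite max_r ?ler0z//; elim: j => [|j IH]; first by rewrite !mul0r; lra.
  have := windowS b k j%:Z; rewrite (_ : j%:Z + 1 = j.+1%:Z); last by lia.
  move=> ->; move: IH; rewrite -!pmulrn -natr1.
  have h1 : g b <= g (b - j%:Z - 1) by apply: g_decr; lia.
  have -> : b + k%:Z - j%:Z - 1 = b + k%:Z - j.+1%:Z by lia.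
  have h2 : g (b + k%:Z - j%:Z) <= g (b + k%:Z - j.+1%:Z) by apply: g_decr; lia.
  have := ler_wpM2l (ler0n R j) h2; lra.
rewrite NegzE; elim: j => [|j IH].
  have := windowS b k (- 1); rewrite addNr max_l ?mul0r; last by rewrite lerz0.
  have h1 : g (b + k%:Z - -1 - 1) >= 0 by [].
  have -> : b - -1 - 1 = b by ring.
  rewrite mulrN1z mulN1r; lra.
have := windowS b k (- j.+2%:Z); rewrite (_ : - j.+2%:Z + 1 = - j.+1%:Z); last by lia.
move: IH; have mx (i : nat) : Num.max 0 (- i%:Z)%:~R = 0 :> R.
  by rewrite max_l// mulrNz oppr_le0.
rewrite !mx !mul0r !mulrNz -!pmulrn -[j.+2%:R]natr1.
have h1 : g (b - - j.+2%:Z - 1) <= g b by apply: g_decr; lia.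
have h2 : g (b + k%:Z - - j.+2%:Z - 1) >= 0 by [].
lra.
Qed.

End window_sum.

Section no_explosion.
Context (R : realType) (a : probability int R) (q : R).
Context (f : R -> R) (w : int -> R).
Let discZ := discrete_int.
Hypothesis a_integrable : summable a (fun y => y%:~R).
Hypothesis a_mean : mean a (fun y => y%:~R) = 0.
Hypothesis a_0 : mass a 0 < 1.
Hypothesis K_finite : forall s : R, 1 <= s -> summable a (fun y => s ^ y).
Hypothesis q_ge0 : 0 <= q.
Hypothesis f_itv : forall x, 0 <= x <= 1 -> 0 <= f x <= 1.
Hypothesis f_incr : forall x y, 0 <= x -> x <= y -> y <= 1 -> f x <= f y.
Hypothesis f_lt : forall s, q < s -> s < 1 -> f s < s.
Hypothesis f_repulsive : exists2 e : R, 0 < e <= 1 & exists2 c : R, 1 < c &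
  forall x, 0 <= x <= e -> c * x <= 1 - f (1 - x).
Hypothesis w_itv : forall n, 0 <= w n <= 1.
Hypothesis w_left : forall n : int, n <= 0 -> w n = 0.
Hypothesis w_incr : forall n k : int, n <= k -> w n <= w k.
Hypothesis w_rec : forall n : int, 0 < n -> w n = mean a (fun y => f (w (n - y))).

Let sf n : summable a (fun y => f (w (n - y))).
Proof.
apply: (summable_bounded _ discZ (c := 1)) => y.
by have /andP[? ?] := f_itv (w_itv (n - y)); rewrite ger0_norm.
Qed.

(* Otherwise [sup w = 1] and [g = min (1 - w) e] satisfies [g n >= c * E g (n - xi)]
   for large [n] with [c > 1]. By [window_shift] and the zero mean of [a], summing
   this over a long window starting at [b] gives [(c - 1) * g b <= o(1)]. *)
Lemma le_fixpoint n : w n <= q.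
Proof.
rewrite leNgt; apply/negP => qw.
pose W := sup (range w).
have supW : has_sup (range w).
  by split; [exists (w 0), 0|exists 1 => _ [k _ <-]; case/andP: (w_itv k)].
have wW k : w k <= W by apply: sup_ubound; [exact: supW.2|exists k].
have W1 : W <= 1.
  by apply: ge_sup; [exact: supW.1|move=> _ [k _ <-]; case/andP: (w_itv k)].
have qW : q < W by exact: lt_le_trans (wW n).
have W0 : 0 <= W by exact: le_trans (ltW qW).
(* The recursion passes to the supremum; [f_lt] then leaves no value strictly between [q] and 1. *)
have WfW : W <= f W.
  apply: ge_sup; first exact: supW.1.
  move=> _ [k _ <-]; have [k0|k0] := leP k 0.
    by rewrite w_left//; have /andP[] := @f_itv W ltac:(lra).
  rewrite w_rec// -[leRHS](mean_cst a); apply: le_mean => //; first exact: summable_cst.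
  by move=> y; apply: f_incr => //; case/andP: (w_itv (k - y)).
have WE : W = 1.
  by apply/eqP; rewrite eq_le W1 leNgt; apply/negP => /(f_lt qW); rewrite ltNge WfW.
have [e /andP[e0 e1] [c c1 He]] := f_repulsive.
have c0 : 0 < c by lra.
pose u k := 1 - w k.
have u_small d : 0 < d -> exists k, u k < d.
  move=> d0; have [_ [k _ <-] wk] := sup_adherent d0 supW.
  by exists k; move: wk; rewrite -/W WE /u; lra.
have u_itv k : 0 <= u k <= 1 by have := w_itv k; rewrite /u; lra.
have u_decr (j k : int) : j <= k -> u k <= u j by move=> /w_incr; rewrite /u; lra.
pose g k := Num.min (u k) e.
have g0 k : 0 <= g k by rewrite le_min (ltW e0) andbT; case/andP: (u_itv k).
have ge k : g k <= e by rewrite ge_min lexx orbT.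
have g_decr (j k : int) : j <= k -> g k <= g j.
  by move=> jk; rewrite le_min ge andbT ge_min u_decr.
have sg k : summable a (fun y => g (k - y)).
  by apply: (summable_bounded _ discZ (c := e)) => y; rewrite ger0_norm.
have u_ge (k : int) : 0 < k -> c * mean a (fun y => g (k - y)) <= u k.
  move=> k0; rewrite /u w_rec// -(mean_cst a 1) -meanB//; last exact: summable_cst.
  rewrite -meanZ//; apply: le_mean.
  - exact: summableZ.
  - by apply: summableB => //; exact: summable_cst.
  move=> y; apply: (@le_trans _ _ (1 - f (1 - g (k - y)))).
    by apply: He; rewrite g0 ge.
  rewrite lerD2l lerN2; apply: f_incr.
  - by case/andP: (w_itv (k - y)).
  - have : g (k - y) <= u (k - y) by rewrite ge_min lexx.
    by rewrite /u; lra.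
  - by rewrite gerBl.
have [y0 [y00 my0]] := right_jump a_integrable a_mean a_0.
have u_gt0 k : 0 < u k.
  suff H (j : nat) : 0 < u j%:Z.
    apply: lt_le_trans (H `|k|%N) (u_decr _ _ _); clear; lia.
  elim: j => [|j IH]; first by rewrite /u w_left// subr0.
  apply: lt_le_trans (u_ge _ _) => //.
  rewrite mulr_gt0//; apply: lt_le_trans (mass_le_mean discZ y0%:Z (sg _) _) => //.
  rewrite mulr_gt0// lt_min e0 andbT (lt_le_trans IH)// u_decr//.
  by move: y00; clear; lia.
(* From [b] on the cap [e] is inactive, so that [g = u] and [u_ge] becomes a gain for [g] itself. *)
have [b ub] := u_small e e0.
have b0 : 0 < b.
  rewrite ltNge; apply/negP => /w_left wb.
  by move: ub; rewrite /u wb subr0 ltNge e1.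
pose E1 := mean a (fun y => Num.max 0 (y%:~R : R)).
have sp := summable_pos_part a_integrable.
have E10 : 0 <= E1 by apply: mean_ge0 => y; rewrite le_max lexx.
pose K4 := Kgf a 4; have s4 : summable a (fun y => 4 ^ y :> R).
  by apply: K_finite; rewrite ler1n.
have K40 : 0 <= K4 by apply: mean_ge0 => y; rewrite exprz_ge0.
have gb : 0 < g b by rewrite lt_min u_gt0.
(* A lower bound for the gain [(c - 1) * S] over the window. [B], and then [k], make each of the two
   error terms at most [t / 4]. *)
pose t := (c - 1) * g b; have t0 : 0 < t by rewrite mulr_gt0// subr_gt0.
pose B := (Num.bound (4 * c * K4 / t)).+1.
have B0 : 0 < B%:R :> R by rewrite ltr0n.
have BP : 4 * c * K4 < t * B%:R.
  rewrite -ltr_pdivrMl// mulrC.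
  have T0 : 0 <= 4 * c * K4 / t.
    by apply: divr_ge0; [rewrite !mulr_ge0// ltW|exact: ltW].
  by apply: lt_le_trans (archi_boundP T0) _; rewrite ler_nat leqnSn.
have E1p : 0 < 4 * c * (E1 + 1) by rewrite !mulr_gt0// ltr_wpDl.
have [j uj] := u_small _ (divr_gt0 t0 E1p).
(* Puts [b + k - B] to the right of [j], where [u] is small enough for the jumps up to [B]. *)
pose k := (`|j| + B).+1.
have k_ge1 : (0 < k)%N by [].
have gk : g (b + k%:Z - B%:Z) * (4 * c * (E1 + 1)) <= t.
  rewrite -ler_pdivlMr// (le_trans _ (ltW uj))// ge_min u_decr//.
  by rewrite /k; move: b0; clear; lia.
(* Up to [B] monotonicity of [g] is enough. Beyond [B], both [B] and [y] are at most [2 ^ y], so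
   [y <= 4 ^ y / B]. *)
have pw (y : int) : Num.max 0 (y%:~R : R) * g (b + k%:Z - y) <=
    g (b + k%:Z - B%:Z) * Num.max 0 (y%:~R : R) + B%:R^-1 * 4 ^ y.
  have [yB|By] := leP y B%:Z.
    rewrite [leLHS]mulrC ler_wpDr ?mulr_ge0 ?invr_ge0 ?exprz_ge0 ?(ltW B0)//.
    by rewrite ler_wpM2r ?le_max ?lexx// g_decr// lerB.
  rewrite ler_wpDl ?mulr_ge0 ?le_max ?lexx//.
  have -> : y = `|y|%N%:Z by move: By; clear; lia.
  have yB : B%:R <= `|y|%N%:R :> R by rewrite ler_nat; move: By; clear; lia.
  rewrite max_r ?ler0z// -pmulrn -exprnP.
  rewrite -ler_pdivrMl ?invr_gt0// invrK.
  have y2 : `|y|%N%:R <= 2 ^+ `|y|%N :> R by rewrite -natrX ler_nat ltnW// ltn_expl.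
  have -> : 4 ^+ `|y|%N = 2 ^+ `|y|%N * 2 ^+ `|y|%N :> R.
    by rewrite -exprMn; congr (_ ^+ _); ring.
  apply: ler_pM => //; first by rewrite mulr_ge0.
    exact: le_trans y2.
  by rewrite (le_trans _ y2)// ler_piMr// (le_trans (ge _)).
have sgk : summable a (fun y => Num.max 0 (y%:~R : R) * g (b + k%:Z - y)).
  apply: (summable_dom discZ sp) => y.
  have m0 : 0 <= Num.max 0 (y%:~R : R) by rewrite le_max lexx.
  by rewrite ger0_norm ?mulr_ge0// ler_piMr// (le_trans (ge _)).
pose S := \sum_(0 <= i < k) g (b + i%:Z).
have S_ge : g b <= S.
  rewrite /S big_nat_recl// addr0 lerDl sumr_ge0// => i _; exact: g0.
have HS : c * mean a (fun y => S + y%:~R * g b -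
    Num.max 0 (y%:~R : R) * g (b + k%:Z - y)) <= S.
  apply: (@le_trans _ _ (c * mean a (fun y => \sum_(0 <= i < k) g (b + i%:Z - y)))).
    rewrite ler_wpM2l ?(ltW c0)//; apply: le_mean.
    - apply: summableB => //; apply: summableD; first exact: summable_cst.
      by under eq_fun do rewrite mulrC; exact: summableZ.
    - by apply: summable_sum => i; exact: sg.
    - by move=> y; exact: window_shift.
  rewrite mean_sum//; rewrite mulr_sumr; apply: ler_sum => i _.
  apply: (le_trans (u_ge _ _)); first by move: b0; clear; lia.
  rewrite le_min lexx/=; apply: ltW; apply: le_lt_trans ub.
  by apply: u_decr; clear; lia.
move: HS; rewrite meanB//; last first.
  apply: summableD; first exact: summable_cst.
  by under eq_fun do rewrite mulrC; exact: summableZ.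
rewrite meanD ?mean_cst; [|exact: summable_cst|]; last first.
  by under eq_fun do rewrite mulrC; exact: summableZ.
under [X in c * (_ + X - _)]eq_mean do rewrite mulrC.
rewrite meanZ// a_mean mulr0 addr0.
have : mean a (fun y => Num.max 0 (y%:~R : R) * g (b + k%:Z - y)) <=
    g (b + k%:Z - B%:Z) * E1 + B%:R^-1 * K4.
  rewrite -!meanZ// -meanD; [|exact: summableZ..].
  by apply: le_mean => //; apply: summableD; exact: summableZ.
move: (mean a (fun y => _ * g _)) => z zle.
have h1 : 4 * (c * (B%:R^-1 * K4)) <= t.
  have -> : 4 * (c * (B%:R^-1 * K4)) = (4 * c * K4) / B%:R by rewrite mulrC; ring.
  by rewrite ler_pdivrMr// ltW.
have h2 : 4 * (c * (g (b + k%:Z - B%:Z) * E1)) <= t.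
  apply: le_trans gk; rewrite mulrDr mulr1 mulrDr.
  have : 0 <= g (b + k%:Z - B%:Z) * (4 * c) by rewrite mulr_ge0// mulr_ge0// ltW.
  lra.
have := ler_wpM2l (ltW c0) zle; rewrite mulrDr => h3 h4.
have : (c - 1) * g b <= (c - 1) * S by rewrite ler_wpM2l// subr_ge0 ltW.
rewrite -/t mulrBl mul1r.
rewrite mulrBr in h4; lra.
Qed.

End no_explosion.

(** * The branching recursion *)

Lemma discrete_measurable_set d (T : measurableType d) d' (S : measurableType d')
    (Z : T -> S) (A : set T) : discrete S ->
  (forall z, measurable (A `&` Z @^-1` [set z])) -> measurable A.
Proof.
move=> [mS /countable_injP[f f_inj]] mA.
have -> : A = \bigcup_k (A `&` Z @^-1` (f @^-1` [set k])).
  by apply/seteqP; split => [t At|t [k _ []//]]; exists (f (Z t)).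
apply: bigcupT_measurable => k.
have [[z zk]|nz] := pselect (exists z, f z = k).
  rewrite (_ : f @^-1` [set k] = [set z])//.
  apply/seteqP; split => x /=; last by move=> ->.
  by rewrite -zk; apply: f_inj; rewrite inE.
rewrite (_ : f @^-1` [set k] = set0) ?preimage_set0 ?setI0//.
by apply/seteqP; split => // x xk; apply: nz; exists x.
Qed.

(** * Disjointness of subtrees in terms of labels *)

Section labels.

(** Labels grow at the head, so [suffix u v] means that [u] is [v] or one of its ancestors. *)
Definition incomparable (u v : label) : bool := ~~ suffix u v && ~~ suffix v u.

Definition children (v : label) (n : nat) : seq label :=
  [seq i :: v | i <- iota 0 n].

(* The variables of the particles in [I] and the subtrees rooted at the
   particles in [J] involve pairwise disjoint sets of labels. *)
Definition separated (I J : seq label) : bool :=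
  [&& uniq I, allrel (fun u v => ~~ suffix v u) I J & pairwise incomparable J].

Lemma suffix_eq_size (u v : label) : suffix u v -> size u = size v -> u = v.
Proof. by rewrite suffixE => + uv; rewrite uv subnn drop0 => /eqP. Qed.

Lemma suffix_consl i (u v : label) : suffix (i :: v) u -> suffix v u.
Proof. exact: (@catl_suffix _ [:: i]). Qed.

Lemma suffix_consr i (u v : label) :
  suffix u (i :: v) -> u = i :: v \/ suffix u v.
Proof.
move=> /suffixP[[|j s]/= E]; [by left|right].
by apply/suffixP; exists s; case: E.
Qed.

Lemma incomparable_cons i (u v : label) : incomparable u v ->
  incomparable u (i :: v).
Proof.
move=> /andP[uv vu]; apply/andP; split.
  apply: contraNN uv => /suffix_consr[uE|//].
  by case/negP: vu; rewrite uE suffix_cons.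
by apply: contraNN vu; exact: suffix_consl.
Qed.

Lemma incomparableC u v : incomparable u v = incomparable v u.
Proof. by rewrite /incomparable andbC. Qed.

Lemma pairwise_children v n : pairwise incomparable (children v n).
Proof.
rewrite pairwise_map; apply: sub_pairwise (_ : pairwise (fun i j => i != j) _).
  move=> i j /=; apply: contraNT; rewrite negb_and !negbK.
  by case/orP => /suffix_eq_size/(_ erefl)[->].
by rewrite -uniq_pairwise iota_uniq.
Qed.

(** The subtree at [v] splits into [v] and the subtrees of its children. The children go in front of
    [J2], which holds the subtrees of smaller depth in [probability_subtrees]. *)
Lemma separated_children I (v : label) (J1 J2 : seq label) n :
  separated I (v :: J1 ++ J2) ->
  v \notin I /\ separated (v :: I) (J1 ++ (children v n ++ J2)).
Proof.
move=> /and3P[uI IJ]; rewrite pairwise_cons all_cat pairwise_cat.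
move=> /andP[/andP[v1 v2] /and3P[J12 pJ1 pJ2]].
have {IJ} [Iv [I1 I2]] : all (fun u => ~~ suffix v u) I /\
    allrel (fun u v => ~~ suffix v u) I J1 /\ allrel (fun u v => ~~ suffix v u) I J2.
  by move: IJ; rewrite allrel_consr allrel_catr => /and3P[].
have vI : v \notin I.
  by apply/negP => /(allP Iv); rewrite suffix_refl.
have ch (u : label) : incomparable v u -> all (incomparable u) (children v n).
  move=> vu; apply/allP => _ /mapP[i _ ->].
  by apply: incomparable_cons; rewrite incomparableC.
split=> //; apply/and3P; split; first by rewrite /= vI.
  rewrite allrel_consl; apply/andP; split.
    rewrite !all_cat; apply/and3P; split.
    - by apply: sub_all v1 => u /andP[].
    - apply/allP => _ /mapP[i _ ->]; apply/negP => /size_suffix.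
      by rewrite /= ltnn.
    - by apply: sub_all v2 => u /andP[].
  rewrite !allrel_catr I1 I2 andbT /=; apply/allrelP => u _ uI' /mapP[i _ ->].
  by apply: contraNN (allP Iv _ uI') => /suffix_consl.
rewrite !pairwise_cat allrel_catr J12 pJ1 pJ2 pairwise_children !andbT /=.
apply/andP; split; apply/allrelP => u u'.
  by move=> /(allP v1) vu; exact: (allP (ch _ vu)).
by move=> uc /(allP v2) vu; rewrite incomparableC; exact: (allP (ch _ vu)).
Qed.

End labels.

(** * Events of bounded depth and their probabilities *)

Section subtrees.
Context d (T : measurableType d) (R : realType) (P : probability T R).
Variables (a : probability int R) (p : probability nat R).
Variables (xi : label -> {RV P >-> int}) (N : label -> {RV P >-> nat}).
Hypothesis brw : branching_random_walk a p xi N.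
Variables (b c : int -> bool).
Let discZ := discrete_int.
Let discN := discrete_nat.

(* Extinction before generation [k] is the case [b = xpred0], [c = predT]; staying
   below [n] up to generation [k] is the case [b = c = (< 0)] started from [- n]. *)
Fixpoint subtree (k : nat) (v : label) (x : int) : set T :=
  if k is j.+1 then
    [set t | c x /\ forall i, (i < N v t)%N -> subtree j (i :: v) (x + xi v t) t]
  else [set t | b x].

Fixpoint subtree_prob (k : nat) (x : int) : R :=
  if k is j.+1 then
    if c x then mean a (fun y => gf p (subtree_prob j (x + y))) else 0
  else (b x)%:R.

Lemma subtree_prob_itv k x : 0 <= subtree_prob k x <= 1.
Proof.
elim: k x => [|k IH] x /=; first by case: (b x); rewrite ?lexx ?ler01.
case: (c x); last by rewrite lexx ler01.
have g_itv y : 0 <= gf p (subtree_prob k (x + y)) <= 1.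
  by rewrite gf_ge0 ?gf_le1//; case/andP: (IH (x + y)).
rewrite mean_ge0/=; last by move=> y; case/andP: (g_itv y).
rewrite -[leRHS](mean_cst a); apply: le_mean; last by move=> y; case/andP: (g_itv y).
- by apply: (summable_bounded _ discZ (c := 1)) => y; rewrite ger0_norm; case/andP: (g_itv y).
- exact: summable_cst.
Qed.

Lemma subtree0 v x : subtree 0 v x = if b x then setT else set0.
Proof. by rewrite /=; case: (b x); apply/seteqP; split. Qed.

Lemma subtree_out k v x : ~~ c x -> subtree k.+1 v x = set0.
Proof. by move=> /negbTE cx; apply/seteqP; split => // t []; rewrite cx. Qed.

Lemma measurable_xi v y : measurable (xi v @^-1` [set y]).
Proof. by rewrite -[X in measurable X]setTI; exact: measurable_funP. Qed.

Lemma measurable_N v n : measurable (N v @^-1` [set n]).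
Proof. by rewrite -[X in measurable X]setTI; exact: measurable_funP. Qed.

(** Once the jump and the family size of [v] are fixed, the random quantifier over children becomes
    a finite intersection over fixed labels started from a fixed site. *)
Lemma subtreeS_atom k v x y n : c x ->
  subtree k.+1 v x `&` xi v @^-1` [set y] `&` N v @^-1` [set n] =
  xi v @^-1` [set y] `&` N v @^-1` [set n] `&`
    \big[setI/setT]_(u <- children v n) subtree k u (x + y).
Proof.
move=> cx; apply/seteqP; split => t.
  move=> [[[_ H] /= ty] tn]; split => //.
  rewrite -bigcap_seq => _ /= /mapP[i + ->]; rewrite mem_iota add0n/= => iN.
  by rewrite -ty; apply: H; rewrite tn.
move=> [[/= ty tn] H]; split => //; split => //; split => // i iN.
move: H; rewrite -bigcap_seq ty; apply => /=.
by apply: map_f; rewrite mem_iota add0n -tn.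
Qed.

Lemma measurable_subtree k v x : measurable (subtree k v x).
Proof.
elim: k v x => [|k IH] v x; first by rewrite subtree0; case: (b x).
have [cx|cx] := boolP (c x); last by rewrite subtree_out.
apply: (discrete_measurable_set (Z := xi v)) => // y.
apply: (discrete_measurable_set (Z := N v)) => // n.
rewrite subtreeS_atom//.
apply: measurableI; first exact: measurableI (measurable_xi _ _) (measurable_N _ _).
by rewrite -bigcap_seq; apply: fin_bigcap_measurable => // u _; exact: IH.
Qed.

Definition values (I : seq label) (z : label -> int * nat) : set T :=
  \big[setI/setT]_(u <- I) (fun t => (xi u t, N u t)) @^-1` [set z u].

Definition subtrees (J : seq (nat * label * int)) : set T :=
  \big[setI/setT]_(j <- J) subtree j.1.1 j.1.2 j.2.

Definition values_prob (I : seq label) (z : label -> int * nat) : R :=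
  \prod_(u <- I) (mass a (z u).1 * mass p (z u).2).

Definition subtrees_prob (J : seq (nat * label * int)) : R :=
  \prod_(j <- J) subtree_prob j.1.1 j.2.

Lemma measurable_values I z : measurable (values I z).
Proof.
rewrite /values -bigcap_seq; apply: fin_bigcap_measurable => // u _.
rewrite (_ : _ @^-1` _ = xi u @^-1` [set (z u).1] `&` N u @^-1` [set (z u).2]).
  exact: measurableI (measurable_xi _ _) (measurable_N _ _).
by apply/seteqP; split => t /=; [move=> <-|case: (z u) => y n /= [-> ->]].
Qed.

Lemma measurable_subtrees J : measurable (subtrees J).
Proof.
rewrite /subtrees -bigcap_seq; apply: fin_bigcap_measurable => // u _.
exact: measurable_subtree.
Qed.

Lemma probability_values I z : uniq I ->
  P (values I z) = (values_prob I z)%:E.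
Proof.
move=> uI; pose J := [fset u | u in I]%fset.
have := particles_independent brw J (A := fun u => [set z u]).
have -> : \bigcap_(i in [set` J]) (fun t => (xi i t, N i t)) @^-1` [set z i] =
    values I z.
  rewrite /values -bigcap_seq (_ : [set` J] = [set` I])//.
  by apply/seteqP; split => u /=; rewrite !inE.
move=> -> => [|u]; last first.
  rewrite (_ : [set z u] = [set (z u).1] `*` [set (z u).2]); first exact: measurableX.
  by apply/seteqP; split => -[y n] /=; case: (z u) => y' n' /= [-> ->].
have pJ : perm_eq J I.
  by apply: uniq_perm => // u; rewrite !inE.
rewrite (perm_big _ pJ)/= /values_prob -prodEFin; apply: eq_bigr => u _.
rewrite EFinM -!massE// -(jump_law brw u) -(offspring_law brw u).
rewrite -(jump_offspring_independent brw u)//.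
by congr (P _); apply/seteqP; split => t /=; [move=> <-|case: (z u) => y n /= [-> ->]].
Qed.

(* Outer induction on the depth, inner induction on the number of subtrees of
   maximal depth: conditioning the root of such a subtree on its jump and its
   offspring replaces it by one more prescribed value and finitely many subtrees
   of smaller depth. *)
Lemma probability_subtrees k : forall (J : seq (nat * label * int)) I z,
  (forall j, j \in J -> (j.1.1 < k)%N) ->
  separated I [seq j.1.2 | j <- J] ->
  P (values I z `&` subtrees J) = (values_prob I z * subtrees_prob J)%:E.
Proof.
elim: k => [|k IHk] J I z.
  case: J => [_ /and3P[uI _ _]|j J /(_ j (mem_head _ _))//].
  by rewrite /subtrees /subtrees_prob !big_nil setIT mulr1 probability_values.
suff H : forall J1 J2 I z, (forall j, j \in J1 -> (j.1.1 <= k)%N) ->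
    (forall j, j \in J2 -> (j.1.1 < k)%N) ->
    separated I [seq j.1.2 | j <- J1 ++ J2] ->
    P (values I z `&` subtrees (J1 ++ J2)) =
    (values_prob I z * subtrees_prob (J1 ++ J2))%:E.
  by move=> Jk sep; rewrite -(cats0 J); apply: H => //; rewrite cats0.
clear J I z; elim=> [|[[k' v] x] J1 IH] J2 I z J1k J2k sep; first exact: IHk.
have J1k' j : j \in J1 -> (j.1.1 <= k)%N.
  by move=> jJ; apply: J1k; rewrite in_cons jJ orbT.
have k'k : (k' <= k)%N by exact: (J1k _ (mem_head _ _)).
rewrite cat_cons /subtrees /subtrees_prob !big_cons -/(subtrees _) -/(subtrees_prob _).
rewrite [(k', v, x).1.1]/= [(k', v, x).1.2]/= [(k', v, x).2]/=.
have sep0 : separated I [seq j.1.2 | j <- J1 ++ J2].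
  move/and3P: sep => [uI IJ /=/andP[_ pJ]]; apply/and3P; split => //.
  by move: IJ; rewrite /= allrel_consr => /andP[].
case: k' k'k sep {J1k} => [|k'] k'k sep.
  rewrite subtree0 /=; case: (b x); first by rewrite setTI mul1r IH.
  by rewrite set0I setI0 measure0 mul0r mulr0.
have [cx|cx] := boolP (c x); last first.
  by rewrite subtree_out// set0I setI0 measure0 /= (negbTE cx) mul0r mulr0.
rewrite [subtree_prob k'.+1 x]/= cx.
set A := values I z `&` _.
pose w := values_prob I z * subtrees_prob (J1 ++ J2).
have w0 : 0 <= w.
  rewrite mulr_ge0// prodr_ge0// => j _; first by rewrite mulr_ge0 ?mass_ge0.
  by case/andP: (subtree_prob_itv j.1.1 j.2).
have mA : measurable A.
  apply: measurableI; first exact: measurable_values.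
  by apply: measurableI; [exact: measurable_subtree|exact: measurable_subtrees].
have atom y n : P (A `&` xi v @^-1` [set y] `&` N v @^-1` [set n]) =
    ((w * mass a y * subtree_prob k' (x + y) ^+ n) * mass p n)%:E.
  pose J3 := [seq (k', u, x + y) | u <- children v n].
  pose z' := [eta z with v |-> (y, n)].
  have J3E : [seq j.1.2 | j <- J3] = children v n.
    by rewrite -map_comp map_id_in.
  have sep1 : v \notin I /\ separated (v :: I) [seq j.1.2 | j <- J1 ++ (J3 ++ J2)].
    move: sep; rewrite /= !map_cat J3E; exact: separated_children.
  have z'I : {in I, z' =1 z}.
    by move=> u uI /=; case: eqP => // uv; move: sep1.1; rewrite -uv uI.
  have -> : A `&` xi v @^-1` [set y] `&` N v @^-1` [set n] =
      values (v :: I) z' `&` subtrees (J1 ++ (J3 ++ J2)).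
    rewrite /A.
    have -> : values (v :: I) z' = xi v @^-1` [set y] `&` N v @^-1` [set n] `&` values I z.
      rewrite /values big_cons; congr (_ `&` _).
        rewrite /= eqxx; apply/seteqP; split => t /=; first by case.
        by move=> [-> ->].
      by apply: eq_big_seq => u uI; rewrite z'I.
    have -> : subtrees (J1 ++ (J3 ++ J2)) =
        \big[setI/setT]_(u <- children v n) subtree k' u (x + y) `&` subtrees (J1 ++ J2).
      rewrite /subtrees !big_cat /= big_map.
      by rewrite setICA.
    have := subtreeS_atom k' v y n cx; set B := subtree _ _ _ => E.
    transitivity (values I z `&` subtrees (J1 ++ J2) `&`
      (B `&` xi v @^-1` [set y] `&` N v @^-1` [set n])).
      by apply/seteqP; split => t /=; tauto.
    by rewrite E; apply/seteqP; split => t /=; tauto.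
  rewrite IH//; last 2 first.
    move=> j; rewrite mem_cat => /orP[/mapP[u _ ->]//|]; exact: J2k.
    by case: sep1.
  congr EFin; rewrite /values_prob big_cons/= eqxx.
  rewrite (eq_big_seq (fun u => mass a (z u).1 * mass p (z u).2)); last first.
    by move=> u uI; rewrite -/(z' u) z'I.
  rewrite -/(values_prob I z) /w /subtrees_prob !big_cat/= big_map big_map.
  (* [subtree_prob] does not depend on the label, so the product over the children is an [n]-th
     power. *)
  rewrite -(big_map (fun=> tt) predT (fun=> subtree_prob k' (x + y))).
  rewrite big_const_seq count_predT size_map size_iota iter_mulr_1; ring.
have g_itv y := subtree_prob_itv k' (x + y).
(* Summing the atoms over the family size turns the power into [gf p]; summing over the jump then
   gives the mean in [subtree_prob]. *)
have PA y : P (A `&` xi v @^-1` [set y]) =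
    ((w * gf p (subtree_prob k' (x + y)))%:E * a [set y])%E.
  pose g n := w * mass a y * subtree_prob k' (x + y) ^+ n.
  have sg : summable p (fun n => subtree_prob k' (x + y) ^+ n) by exact: summable_gf.
  rewrite (@total_probability _ nat R p discN _ T P (N v) _ (fun n => (g n)%:E)).
  - rewrite mean_integral; last exact: summableZ.
    by rewrite /g meanZ// -/(gf p _) massE// -EFinM; congr EFin; ring.
  - move=> n; apply: measurableI; last exact: measurable_N.
    exact: measurableI mA (measurable_xi _ _).
  - move=> n; rewrite lee_fin /g; apply: mulr_ge0.
      by rewrite mulr_ge0 ?mass_ge0.
    by rewrite exprn_ge0//; case/andP: (g_itv y).
  - by move=> n; rewrite massE// -EFinM; exact: atom.
rewrite (@total_probability _ int R a discZ _ T P (xi v) _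
  (fun y => (w * gf p (subtree_prob k' (x + y)))%:E)).
- have sg : summable a (fun y => gf p (subtree_prob k' (x + y))).
    apply: (summable_bounded _ discZ (c := 1)) => y.
    by rewrite ger0_norm ?gf_le1// gf_ge0//; case/andP: (g_itv y).
  rewrite mean_integral; last exact: summableZ.
  by rewrite meanZ//; congr EFin; rewrite /w; ring.
- by move=> y; apply: measurableI => //; exact: measurable_xi.
- by move=> y; rewrite lee_fin mulr_ge0// gf_ge0//; case/andP: (g_itv y).
- exact: PA.
Qed.

Lemma probability_subtree k v x : P (subtree k v x) = (subtree_prob k x)%:E.
Proof.
have := @probability_subtrees k.+1 [:: (k, v, x)] [::] (fun=> (0, 0%N)).
rewrite /values /subtrees /values_prob /subtrees_prob !big_cons !big_nil.
rewrite setTI setIT mul1r mulr1; apply => //.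
by move=> j; rewrite inE => /eqP ->.
Qed.

End subtrees.

(* [s ++ v] belongs to the family tree as soon as [v] does. *)
Fixpoint alive (N : label -> nat) (v s : label) : bool :=
  if s is i :: u then alive N v u && (i < N (u ++ v))%N else true.

(** [alive] recurs from the youngest particle, [subtree] from the root; this exchanges the two
    directions. *)
Lemma alive_rcons N v s i :
  alive N v (rcons s i) = (i < N v)%N && alive N (i :: v) s.
Proof.
elim: s => [|j s IH] /=; first by rewrite andbT.
by rewrite IH cat_rcons andbA.
Qed.

Lemma mem_generation N k v :
  (v \in generation N k) = (size v == k) && alive N [::] v.
Proof.
elim: k v => [|k IH] v; first by rewrite inE; case: v.
apply/allpairsPdep/idP => [[u [i [+ + ->]]]|].
  rewrite IH mem_iota add0n /= eqSS => /andP[/eqP <- au] iN.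
  by rewrite eqxx au cats0.
case: v => // i u /=; rewrite eqSS cats0 => /and3P[us au iN].
by exists u, i; rewrite IH us au mem_iota.
Qed.

(** * From bounded depth to extinction and to the all-time maximum *)

Section genealogy.
Context d (T : measurableType d) (R : realType) (P : probability T R).
Variables (a : probability int R) (p : probability nat R).
Variables (xi : label -> {RV P >-> int}) (N : label -> {RV P >-> nat}).
Hypothesis brw : branching_random_walk a p xi N.
Hypothesis p2 : summable p (fun k => k%:R ^+ 2).
Let discZ := discrete_int.

(** The last letter of [s] is the first step away from [v]. Starting from [X v] lets the induction
    hypothesis apply to the children verbatim. *)
Lemma subtreeP b c k v (x : int) t (X := fun u => x + position (xi^~ t) u) :
  subtree xi N b c k v (X v) t <->
  forall s, alive (N^~ t) v s ->
    ((size s < k)%N -> c (X (s ++ v))) /\ (size s = k -> b (X (s ++ v))).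
Proof.
elim: k v => [|k IH] v /=.
  split => [bv s _|H]; last by have [_] := H [::] isT; apply.
  by split => // /size0nil ->.
have XE i : X v + xi v t = X (i :: v) by rewrite /X /= addrA.
split => [[cv H] s|H].
  case/lastP: s => [|s i]; first by split.
  rewrite alive_rcons size_rcons cat_rcons => /andP[iN si].
  have := H i iN; rewrite (XE i) IH => /(_ _ si)[h1 h2].
  by split=> [|[]].
split; first by have [+ _] := H [::] isT; apply.
move=> i iN; rewrite (XE i) IH => s si.
have := H (rcons s i); rewrite alive_rcons iN si size_rcons cat_rcons.
by move=> /(_ isT)[h1 h2]; split => [|sk]; [exact: h1|apply: h2; rewrite sk].
Qed.


Lemma generation_size_eq0 k t :
  generation_size N k t = 0%N <-> forall s, alive (N^~ t) [::] s -> size s <> k.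
Proof.
split => [/size0nil H s sa sk|H].
  by have := mem_generation (N^~ t) k s; rewrite H sa sk eqxx.
apply/eqP; rewrite size_eq0; case E: (generation _ _) => [//|s l].
have := mem_generation (N^~ t) k s; rewrite E mem_head => /esym/andP[/eqP sk sa].
by case: (H s sa).
Qed.

Lemma extinction_prob_lim : iter k (gf p) 0 @[k --> \oo] --> extinction_prob N.
Proof.
pose F k := subtree xi N xpred0 predT k [::] 0.
have FP k t : F k t <-> generation_size N k t = 0%N.
  rewrite /F generation_size_eq0; have := @subtreeP xpred0 predT k [::] 0 t.
  rewrite /= addr0 => ->; split => [H s sa sk|H s sa].
    by have [_ /(_ sk)] := H s sa.
  by split => // sk; case: (H s sa).
have PF k : P (F k) = (iter k (gf p) 0)%:E.
  rewrite (probability_subtree brw); congr EFin.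
  elim: k (0 : int) => //= k IH x.
  by under eq_mean do rewrite IH; rewrite mean_cst.
have mF k : measurable (F k) by exact: measurable_subtree.
have FU : [set t | exists n, (1 <= n)%N /\ generation_size N n t = 0%N] = \bigcup_k F k.
  apply/seteqP; split => [t [n [_ n0]]|t [n _ /FP n0]]; first by exists n => //; apply/FP.
  (* Generation 0 contains the root, so the condition [1 <= n] excludes nothing. *)
  by case: n n0 => [//|n] n0; exists n.+1.
have ndF : nondecreasing_seq F.
  apply/nondecreasing_seqP => k; apply/subsetPset => t /FP/size0nil H.
  by apply/FP; rewrite /generation_size /= H.
have := @nondecreasing_cvg_mu _ T R P F mF (bigcupT_measurable F mF) ndF.
rewrite -FU /extinction_prob; set E := [set t | _] => H.
have fE : P E \is a fin_num by rewrite fin_num_measure// /E FU; exact: bigcupT_measurable.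
have /fine_cvgP[_] : (P \o F) @ \oo --> (fine (P E))%:E by rewrite fineK.
apply: cvg_trans.
by apply: near_eq_cvg; near=> k; rewrite /= PF.
Unshelve. all: by end_near.
Qed.

Let below n k := subtree xi N (< 0) (< 0) k [::] (- n).

Let belowP (n : int) k t : below n k t <->
  forall s, alive (N^~ t) [::] s -> (size s <= k)%N -> position (xi^~ t) s < n.
Proof.
rewrite /below; have := @subtreeP (< 0) (< 0) k [::] (- n) t; rewrite /= addr0 => ->.
split => H s sa; have := H s sa; rewrite cats0 !(addrC (- n)) !subr_lt0.
  by move=> [h1 h2]; rewrite leq_eqVlt => /orP[/eqP|].
by move=> h; split => [/ltnW/h//|sk]; apply: h; rewrite sk.
Qed.

Definition below_prob (n : int) : R := fine (P (\bigcap_k below n k)).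

Let mbelow n k : measurable (below n k). Proof. exact: measurable_subtree. Qed.

Let bigcap_belowP (n : int) t : (\bigcap_k below n k) t <->
  forall s, alive (N^~ t) [::] s -> position (xi^~ t) s < n.
Proof.
split => [H s sa|H k _]; last by apply/belowP => s sa _; exact: H.
by have /belowP := H (size s) I; apply.
Qed.

Lemma below_prob_lim n :
  subtree_prob a p (< 0) (< 0) k (- n) @[k --> \oo] --> below_prob n.
Proof.
have niF : nonincreasing_seq (below n).
  apply/nonincreasing_seqP => k; apply/subsetPset => t /belowP H.
  by apply/belowP => s sa sk; apply: H => //; exact: leqW.
have := fun f0 => @nonincreasing_cvg_mu _ T R P (below n) f0 (mbelow n)
  (bigcapT_measurable (mbelow n)) niF.
have f0 : (P (below n 0) < +oo)%E by rewrite (le_lt_trans (probability_le1 _ _))// ltry.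
move=> /(_ f0); rewrite /below_prob; set E := \bigcap_k _ => H.
have fE : P E \is a fin_num by rewrite fin_num_measure//; exact: bigcapT_measurable.
have /fine_cvgP[_] : (P \o below n) @ \oo --> (fine (P E))%:E by rewrite fineK.
apply: cvg_trans.
by apply: near_eq_cvg; near=> k; rewrite /= (probability_subtree brw).
Unshelve. all: by end_near.
Qed.

Lemma below_prob_itv n : 0 <= below_prob n <= 1.
Proof.
have mE := bigcapT_measurable (mbelow n).
rewrite fine_ge0//= -lee_fin fineK ?probability_le1//.
exact: fin_num_measure.
Qed.

Lemma below_prob_left (n : int) : n <= 0 -> below_prob n = 0.
Proof.
move=> n0; have E k : subtree_prob a p (< 0) (< 0) k (- n) = 0.
  by case: k => [|k] /=; rewrite oppr_lt0 ltNge n0.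
have /cvg_lim <- // := @below_prob_lim n; apply/cvg_lim => //.
by under eq_fun do rewrite E; exact: cvg_cst.
Qed.

Lemma below_prob_incr (n k : int) : n <= k -> below_prob n <= below_prob k.
Proof.
move=> nk; have mE j := bigcapT_measurable (mbelow j).
apply: fine_le; try exact: fin_num_measure.
apply: le_measure; rewrite ?inE// => t /bigcap_belowP H.
by apply/bigcap_belowP => s sa; exact: lt_le_trans (H s sa) nk.
Qed.

(** The recursion of [subtree_prob] passes to the limit in the depth by continuity of [gf p] and
    bounded convergence. *)
Lemma below_prob_rec (n : int) : 0 < n ->
  below_prob n = mean a (fun y => gf p (below_prob (n - y))).
Proof.
move=> n0; have /cvg_lim <- // := @below_prob_lim n; apply/cvg_lim => //.
rewrite -(cvg_shiftS (fun k => subtree_prob _ _ _ _ k (- n))) /= oppr_lt0 n0.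
have sp_itv := subtree_prob_itv a p (< 0) (< 0).
apply: (mean_cvg discZ (c := 1)) => [k y|y].
  by rewrite ger0_norm ?gf_le1// gf_ge0//; case/andP: (sp_itv k (- n + y)).
have -> : - n + y = - (n - y) by rewrite opprB addrC.
apply: (gf_cvg p2 (fun k => sp_itv k _) (below_prob_itv _)).
exact: below_prob_lim.
Qed.

Lemma maximum_tailE (n : nat) : maximum_tail xi N n = 1 - below_prob n%:Z.
Proof.
have mE := bigcapT_measurable (mbelow n%:Z).
rewrite /maximum_tail.
have -> : [set t | (n%:R%:E <= maximal_position xi N t)%E] =
    ~` (\bigcap_k below n%:Z k).
  apply/seteqP; split => t /=.
    move=> nM /bigcap_belowP H; move: nM; rewrite leNgt => /negP; apply.
    (* Positions are integers: if all are below [n], they are at most [n - 1], so the supremum stays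
       strictly below [n]. *)
    rewrite /maximal_position; apply: (@le_lt_trans _ _ (n%:R - 1)%:E); last first.
      by rewrite lte_fin ltrBlDr ltrDl.
    apply: ge_ereal_sup => _ [v [k +] <-]; rewrite mem_generation => /andP[_ /H pn].
    rewrite lee_fin lerBrDr (_ : n%:R = n%:Z%:~R)// (_ : 1 = 1%:~R)// -intrD ler_int.
    by move: pn; clear; lia.
  move=> H; have [s [sa ns]] : exists s, alive (N^~ t) [::] s /\ n%:Z <= position (xi^~ t) s.
    apply: contrapT => H'; apply: H; apply/bigcap_belowP => s sa.
    by rewrite ltNge; apply/negP => ns; apply: H'; exists s.
  apply: (@le_trans _ _ ((position (xi^~ t) s)%:~R)%:E).
    by rewrite lee_fin (_ : n%:R = n%:Z%:~R)// ler_int.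
  apply: ereal_sup_ubound; exists s => //; exists (size s).
  by rewrite mem_generation eqxx.
rewrite probability_setC// fineB//; first exact: fin_num_measure.
Qed.

End genealogy.

(** * Lower and upper limits, and the conclusion *)

Section extended_limits.
Context (R : realType) (u : nat -> R).

Lemma limn_einf_ge (c : R) (n0 : nat) :
  (forall n, (n0 <= n)%N -> c <= u n) -> (c%:E <= limn_einf (fun n => (u n)%:E))%E.
Proof.
move=> cu; rewrite limn_einf_lim; apply: lime_ge; first exact: is_cvg_einfs.
near=> n; apply: le_ereal_inf_tmp => _ [k /= nk <-]; rewrite lee_fin cu//.
by rewrite (leq_trans _ nk)//; near: n; exact: nbhs_infty_ge.
Unshelve. all: by end_near.
Qed.

Lemma limn_esup_le (c : R) :
  (forall n, u n <= c) -> (limn_esup (fun n => (u n)%:E) <= c%:E)%E.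
Proof.
move=> uc; rewrite limn_esup_lim; apply: lime_le; first exact: is_cvg_esups.
by near=> n; apply: ge_ereal_sup => _ [k /= nk <-]; rewrite lee_fin.
Unshelve. all: by end_near.
Qed.

End extended_limits.

Theorem proposition1p10 (R : realType) (d : measure_display)
    (T : measurableType d) (P : probability T R)
    (a : probability int R) (p : probability nat R)
    (xi : label -> {RV P >-> int}) (N : label -> {RV P >-> nat})
    (brw : branching_random_walk a p xi N)
    (p_mean : (1 < 'E_p[(fun k : nat => k%:R)%R])%E)
    (p_0 : 0 < mass p 0%N)
    (p_moment3 : ('E_p[(fun k : nat => k%:R ^+ 3)%R] < +oo)%E)
    (a_integrable : a.-integrable setT (fun y : int => y%:~R%:E))
    (a_mean : ('E_a[(fun y : int => y%:~R)%R] = 0)%E)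
    (a_variance : ('V_a[(fun y : int => y%:~R)%R] < +oo)%E)
    (a_0 : mass a (0 : int) < 1)
    (K_finite : forall theta : R, 1 <= theta -> (step_gf a theta < +oo)%E) :
  let q := extinction_prob N in
  let ell := ell_bar a p xi N in
  [/\ (0 < limn_einf (fun n => (ell n)%:E))%E,
      (limn_einf (fun n => (ell n)%:E) <= limn_esup (fun n => (ell n)%:E))%E &
      (limn_esup (fun n => (ell n)%:E) <= q%:E)%E] /\
  forall r : nat, right_range a r -> nearly_right_continuous a r ->
    exists kappa' : R, [/\ 0 < kappa', kappa' <= q & ell @ \oo --> kappa'].
Proof.
move=> q ell.
have discN := discrete_nat; have discZ := discrete_int.
have p3 : summable p (fun k => k%:R ^+ 3).
  by apply: summable_ge0 => //; move: p_moment3; rewrite unlock.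
have p2 : summable p (fun k => k%:R ^+ 2).
  apply: (summable_dom discN p3) => -[|k]; first by rewrite !expr0n normr0.
  by rewrite ger0_norm ?sqr_ge0// ler_weXn2l ?ler1n.
have p1s : summable p (fun k => k%:R).
  apply: (summable_dom discN p2) => -[|k]; first by rewrite expr0n normr0.
  by rewrite ger0_norm// expr2 ler_peMr ?ler1n.
have p1 : 1 < mean p (fun k => k%:R).
  by move: p_mean; rewrite unlock mean_integral.
have a_mean0 : mean a (fun y => y%:~R) = 0.
  by move: a_mean; rewrite unlock mean_integral// => -[].
have K_sum s : 1 <= s -> summable a (fun y => s ^ y).
  move=> s1; apply: summable_ge0 => // [y|]; first by rewrite exprz_ge0// (le_trans _ s1).
  by have := K_finite s s1; rewrite /step_gf unlock.
have q_lim := extinction_prob_lim brw; rewrite -/q in q_lim.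
have q0 : 0 < q by exact: (fixpoint_gt0 p2 p1 p_0 q_lim).
have q1 : q < 1 by exact: (fixpoint_lt1 p2 p1 q_lim).
have gfq : gf p q = q by exact: (gf_fixpoint p2 p1 p_0 q_lim).
pose m := gf_slope p q.
have m01 : 0 < m < 1.
  by rewrite (gf_slope_fixpoint_gt0 p2 p1 p_0 q_lim) (gf_slope_lt1 p2 p1 p_0 q_lim).
have m0 : 0 < m by case/andP: m01.
have [r1 Kr] : 1 < rho_bar a p N /\ Kgf a (rho_bar a p N) = m^-1.
  rewrite /rho_bar -/q derive1_offspring_gf ?q0//.
  by apply: rhoP => //; rewrite -/m invf_gt1//; case/andP: m01.
set r := rho_bar a p N in r1 Kr.
pose w := below_prob xi N.
have w_itv n : 0 <= w n <= 1 by exact: below_prob_itv.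
have w_left n : n <= 0 -> w n = 0 by exact: (below_prob_left brw).
have w_incr n k : n <= k -> w n <= w k by exact: below_prob_incr.
have w_rec n : 0 < n -> w n = mean a (fun y => gf p (w (n - y))).
  exact: (below_prob_rec brw p2).
(* This makes [h] nonnegative, so that its values lie where [phi] is controlled. *)
have wq : forall n, w n <= q.
  apply: (le_fixpoint (f := gf p) a_integrable a_mean0 a_0 K_sum (ltW q0)) => //.
  - by move=> x x01; rewrite gf_le1// gf_ge0//; case/andP: x01.
  - by move=> x y; exact: le_gf.
  - exact: (gf_lt p2 p1 p_0 q_lim).
  - exact: gf_repulsive.
pose phi x := gf p q - gf p (q - x).
pose h n := q - w n.
have phi0 : phi 0 = 0 by rewrite /phi subr0 subrr.
have phi_incr x y : 0 <= x -> x <= y -> y <= q -> phi x <= phi y.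
  by move=> x0 xy yq; rewrite lerD2l lerN2 le_gf//; lra.
have phi_lip x y : 0 <= x -> x <= y -> y <= q -> phi y - phi x <= m * (y - x).
  move=> x0 xy yq.
  have := @gf_lipschitz _ p p2 (q - y) (q - x) ltac:(lra) ltac:(lra) ltac:(lra).
  have := @le_gf_slope _ p p2 (q - x) q ltac:(lra) ltac:(lra) ltac:(lra).
  rewrite -/m => h1; have yx : 0 <= y - x by lra.
  by have := ler_wpM2r yx h1; rewrite /phi; lra.
have phi_lower x : 0 <= x <= q -> m * x - second_moment p * x ^+ 2 <= phi x.
  move=> x0q; have /andP[_] := @gf_tangent _ p p2 q (q - x) ltac:(lra) ltac:(lra).
  by rewrite -/m /phi; lra.
have h_itv n : 0 <= h n <= q.
  by rewrite subr_ge0 wq gerBl; case/andP: (w_itv n).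
have h_left n : n <= 0 -> h n = q by move=> n0; rewrite /h w_left// subr0.
have h_decr (n k : int) : n <= k -> h k <= h n.
  by move=> nk; rewrite lerD2l lerN2 w_incr.
have h_rec n : 0 < n -> h n = mean a (fun y => phi (h (n - y))).
  move=> n0; rewrite /h w_rec// -{1}gfq -(mean_cst a (gf p q)) -meanB.
  - by apply: eq_mean => y; rewrite /phi subKr.
  - exact: summable_cst.
  apply: (summable_bounded _ discZ (c := 1)) => y.
  by rewrite ger0_norm ?gf_le1// gf_ge0//; case/andP: (w_itv (n - y)).
have mKr : m * Kgf a r = 1 by rewrite Kr mulfV// gt_eqF.
have C0 := second_moment_ge0 p.
have r0 : 0 < r by exact: lt_trans r1.
have ellE n : ell n = r ^+ n * h n%:Z.
  by rewrite /ell /ell_bar maximum_tailE -/q -/w /h; congr (_ * _); ring.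
have decayE (n : nat) : r ^+ n * r ^ (- n%:Z) = 1.
  by rewrite -exprnN mulfV// gt_eqF// exprn_gt0.
have ell_le n : ell n <= q.
  have := tail_upper q0 m01 r1 K_sum mKr phi0 phi_incr phi_lip h_itv h_left h_rec n%:Z.
  move/(ler_wpM2l (ltW (exprn_gt0 n r0))).
  by rewrite -ellE mulrCA decayE mulr1.
have [y0 [y00 my0]] := right_jump a_integrable a_mean0 a_0.
have h_gt0 := tail_gt0 q0 m01 C0 phi0 phi_incr phi_lip phi_lower h_itv h_left h_decr
  h_rec y00 my0.
have [e e0 [n1 hn1]] := tail_lower q0 m01 C0 r1 K_sum mKr phi0 phi_incr phi_lip phi_lower
  h_itv h_decr h_rec h_gt0.
have ell_ge n : (n1 <= n)%N -> e <= ell n.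
  move=> /hn1/(ler_wpM2l (ltW (exprn_gt0 n r0))).
  by rewrite -ellE mulrCA decayE mulr1.
split.
  split; [|exact: limn_einf_sup|exact: limn_esup_le].
  by apply: lt_le_trans (limn_einf_ge ell_ge); rewrite lte_fin.
move=> R0 [R00 _ a_right] [_ a_pos].
have [l] := tail_limit q0 m01 C0 r1 K_sum mKr phi0 phi_incr phi_lip phi_lower
  h_itv h_left h_rec R00 a_right a_pos.
rewrite (_ : (fun n : nat => _) = ell); last by apply/funext => n; rewrite ellE.
move=> ell_l; exists l; have ell_cvg : cvgn ell by apply/cvg_ex; exists l.
split => //; have /cvg_lim <- // := ell_l.
  by apply: lt_le_trans e0 _; apply: limr_ge => //; near=> n; apply: ell_ge;
     near: n; exact: nbhs_infty_ge.
by apply: limr_le => //; near=> n.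
Unshelve. all: by end_near.
Qed.
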